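(* The group $(F_4)^{\gamma_3}\cap(F_4)^{\sigma_3}$ is isomorphic to $(U(1)\times Sp(1)\times U(2))/\mathbb{Z}_2$, where $\mathbb{Z}_2=\{(1,1,E),(-1,-1,-E)\}$.
   Context: Let $\mathbf{H}$ be the quaternions with units $e_1,e_2,e_3=e_1e_2$, and $\mathbf{C}=\{x+ye_1: x,y\in\mathbb{R}\}\subset\mathbf{H}$. Let $\mathfrak{C}=\mathbf{H}\oplus\mathbf{H}e_4$ be the division Cayley algebra with multiplication $(m+ne_4)(p+qe_4)=(mp-\bar q n)+(n\bar p+qm)e_4$ and conjugation $\overline{m+ne_4}=\bar m-ne_4$. Let $\mathfrak{J}=\{X\in M(3,\mathfrak{C}): X^*=X\}$ be the exceptional Jordan algebra, with $X\circ Y=\tfrac12(XY+YX)$; its elements are $$X=\begin{pmatrix}\xi_1&x_3&\overline{x_2}\\ \overline{x_3}&\xi_2&x_1\\ x_2&\overline{x_1}&\xi_3\end{pmatrix},\quad \xi_i\in\mathbb{R},\ x_i\in\mathfrak{C}.$$ Put $F_4=\{\alpha\in\mathrm{Iso}_{\mathbb{R}}(\mathfrak{J}):\alpha(X\circ Y)=\alpha X\circ\alpha Y\}$, where $\mathrm{Iso}_{\mathbb{R}}$ denotes $\mathbb{R}$-linear isomorphisms. Let $\boldsymbol{\omega}=-\tfrac12+\tfrac{\sqrt3}{2}e_1$. On $\mathfrak{C}$ let $\gamma_3(m+ne_4)=m+(\boldsymbol{\omega}n)e_4$, and let $\gamma_3\in F_4$ be the map fixing each $\xi_i$ and sending $x_i\mapsto\gamma_3x_i$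 ($i=1,2,3$). Let $\sigma_3\in F_4$ be the map fixing each $\xi_i$ and sending $x_1\mapsto\bar{\boldsymbol{\omega}}x_1\bar{\boldsymbol{\omega}}$, $x_2\mapsto\boldsymbol{\omega}x_2$, $x_3\mapsto x_3\boldsymbol{\omega}$. For $g\in F_4$, $(F_4)^g=\{\alpha\in F_4: g^{-1}\alpha g=\alpha\}$. $Sp(1)$ is the group of unit quaternions, $U(1)$ the group of unit complex numbers, and $E$ the unit matrix. *)

(* Defs.v *)
From HB Require Import structures.
From mathcomp Require Import all_boot all_order all_algebra.
From mathcomp Require Import ring lra.
From mathcomp Require Import complex.
From mathcomp Require Import all_classical all_reals all_analysis.

Set Implicit Arguments.
Unset Strict Implicit.
Unset Printing Implicit Defensive.

Import Order.TTheory GRing.Theory Num.Theory.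
Import numFieldNormedType.Exports.

Local Open Scope classical_set_scope.
Local Open Scope ring_scope.

(* Continuity of multiplication and inversion is not part of this structure:
   it only serves to speak of isomorphisms that are also homeomorphisms. *)
#[short(type="groupTopologyType")]
HB.structure Definition GroupTopology := {G of Topological G & Group G}.

HB.instance Definition _ (G H : groupTopologyType) := Group.on (G * H)%type.

(* isomorphism of (compact) Lie groups: a group isomorphism which is a
   homeomorphism *)
Definition isomorphic (G H : groupTopologyType) : Prop :=
  exists (f : G -> H) (g : H -> G),
    [/\ cancel f g, cancel g f, {morph f : x y / (x * y)%g},
        continuous f & continuous g].

Section Subgroups.
Variable G : groupType.

Record subgroup := Subgroup {
  subgroup_set :> set G;
  subgroup1 : subgroup_set 1%g;
  subgroupM : forall x y,
    subgroup_set x -> subgroup_set y -> subgroup_set (x * y)%g;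
  subgroupV : forall x, subgroup_set x -> subgroup_set (x^-1)%g }.

Program Definition subgroupI (H K : subgroup) :=
  @Subgroup (H `&` K) _ _ _.
Next Obligation. by move=> H K; split; exact: subgroup1. Qed.
Next Obligation.
by move=> H K x y [Hx Kx] [Hy Ky]; split; exact: subgroupM.
Qed.
Next Obligation. by move=> H K x [Hx Kx]; split; exact: subgroupV. Qed.

Definition subgroup_type (H : subgroup) : Type := set_type H.

Record normal_subgroup := NormalSubgroup {
  normal_subgroup_subgroup :> subgroup;
  normal_subgroupJ : forall x y,
    subgroup_set normal_subgroup_subgroup x ->
    subgroup_set normal_subgroup_subgroup (x ^ y)%g }.

End Subgroups.

Section SubgroupGroup.
Variables (G : groupType) (H : subgroup G).
Local Notation sH := (subgroup_type H).

HB.instance Definition _ := Choice.copy sH (set_type H).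

Lemma subgroup_typeP (x : sH) : subgroup_set H (val x).
Proof. by have := valP x; rewrite inE. Qed.

Definition subgroup_one : sH := SigSub (mem_set (subgroup1 H)).
Definition subgroup_mul (x y : sH) : sH :=
  SigSub (mem_set (subgroupM (subgroup_typeP x) (subgroup_typeP y))).
Definition subgroup_inv (x : sH) : sH :=
  SigSub (mem_set (subgroupV (subgroup_typeP x))).

Lemma subgroup_mulA : associative subgroup_mul.
Proof. by move=> x y z; apply: val_inj; exact: mulgA. Qed.
Lemma subgroup_mul1 : left_id subgroup_one subgroup_mul.
Proof. by move=> x; apply: val_inj; exact: mul1g. Qed.
Lemma subgroup_mulr1 : right_id subgroup_one subgroup_mul.
Proof. by move=> x; apply: val_inj; exact: mulg1. Qed.
Lemma subgroup_mulV : left_inverse subgroup_one subgroup_inv subgroup_mul.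
Proof. by move=> x; apply: val_inj; exact: mulVg. Qed.
Lemma subgroup_mulrV : right_inverse subgroup_one subgroup_inv subgroup_mul.
Proof. by move=> x; apply: val_inj; exact: mulgV. Qed.

HB.instance Definition _ := isGroup.Build sH
  subgroup_mulA subgroup_mul1 subgroup_mulr1 subgroup_mulV subgroup_mulrV.
End SubgroupGroup.

HB.instance Definition _ (G : groupTopologyType) (H : subgroup G) :=
  Topological.copy (subgroup_type H) (set_type H).

Section Quotient.
Local Open Scope quotient_scope.
Variables (G : groupType) (N : normal_subgroup G).

Definition coset_rel (x y : G) : bool := `[< subgroup_set N (x^-1 * y)%g >].

Lemma coset_rel_equiv : equiv_class_of coset_rel.
Proof.
split.
- by move=> x; apply/asboolP; rewrite mulVg; exact: subgroup1.
- move=> x y; apply/asboolP/asboolP => /subgroupV;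
    by rewrite invgM invgK.
- move=> y x z /asboolP xy /asboolP yz; apply/asboolP.
  by have := subgroupM xy yz; rewrite mulgA mulgK.
Qed.

Definition coset_equiv := EquivRelPack coset_rel_equiv.

Definition quotient_group : Type := {eq_quot coset_equiv}.

HB.instance Definition _ := Quotient.copy quotient_group {eq_quot coset_equiv}.
HB.instance Definition _ := [Choice of quotient_group by <:%/].

Local Notation Q := quotient_group.

Lemma coset_piP (x y : G) : \pi_Q x = \pi_Q y <-> subgroup_set N (x^-1 * y)%g.
Proof.
split=> [/eqmodP/asboolP //|h].
by apply/eqmodP/asboolP.
Qed.

Definition quot_one : Q := \pi_Q 1%g.
Definition quot_mul (x y : Q) : Q := \pi_Q (repr x * repr y)%g.
Definition quot_inv (x : Q) : Q := \pi_Q (repr x)^-1%g.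

Lemma quot_mul_pi (x y : G) : quot_mul (\pi_Q x) (\pi_Q y) = \pi_Q (x * y)%g.
Proof.
apply/coset_piP.
have /coset_piP hx : \pi_Q (repr (\pi_Q x)) = \pi_Q x by rewrite reprK.
have /coset_piP hy : \pi_Q (repr (\pi_Q y)) = \pi_Q y by rewrite reprK.
have := subgroupM (normal_subgroupJ (repr (\pi_Q y)) hx) hy.
by rewrite conjgE invgM !mulgA mulgK.
Qed.

Lemma quot_inv_pi (x : G) : quot_inv (\pi_Q x) = \pi_Q (x^-1)%g.
Proof.
apply/coset_piP.
have /coset_piP hx : \pi_Q x = \pi_Q (repr (\pi_Q x)) by rewrite reprK.
have := normal_subgroupJ (x^-1)%g hx.
by rewrite conjgE !invgK !mulgA mulgV mul1g.
Qed.

Lemma quot_surj (x : Q) : exists a, x = \pi_Q a.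
Proof. by exists (repr x); rewrite reprK. Qed.

Lemma quot_mulA : associative quot_mul.
Proof.
move=> x y z; case: (quot_surj x) (quot_surj y) (quot_surj z).
by move=> a -> [b ->] [c ->]; rewrite !quot_mul_pi mulgA.
Qed.
Lemma quot_mul1 : left_id quot_one quot_mul.
Proof. by move=> x; case: (quot_surj x) => a ->; rewrite quot_mul_pi mul1g. Qed.
Lemma quot_mulr1 : right_id quot_one quot_mul.
Proof. by move=> x; case: (quot_surj x) => a ->; rewrite quot_mul_pi mulg1. Qed.
Lemma quot_mulV : left_inverse quot_one quot_inv quot_mul.
Proof. by move=> x; case: (quot_surj x) => a ->; rewrite quot_inv_pi quot_mul_pi mulVg. Qed.
Lemma quot_mulrV : right_inverse quot_one quot_inv quot_mul.
Proof. by move=> x; case: (quot_surj x) => a ->; rewrite quot_inv_pi quot_mul_pi mulgV. Qed.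

HB.instance Definition _ := isGroup.Build quotient_group
  quot_mulA quot_mul1 quot_mulr1 quot_mulV quot_mulrV.
End Quotient.

HB.instance Definition _ (G : groupTopologyType) (N : normal_subgroup G) :=
  Topological.copy (quotient_group N) (quotient_topology (quotient_group N)).

Section QuotientTopology.
Local Open Scope quotient_scope.
Variables (G : groupTopologyType) (N : normal_subgroup G).
Local Notation pi := (\pi_(quotient_group N) : G -> quotient_group N).

Lemma quotient_group_openE (A : set (quotient_group N)) :
  open A = open (pi @^-1` A).
Proof. by []. Qed.

Lemma quotient_group_pi_continuous : continuous pi.
Proof. by apply/continuousP => A; rewrite quotient_group_openE. Qed.

Lemma quotient_group_continuous (Z : topologicalType)
    (f : quotient_group N -> Z) : continuous (f \o pi) -> continuous f.
Proof.
move=> /continuousP h; apply/continuousP => A oA.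
by rewrite quotient_group_openE; exact: h.
Qed.

Lemma quotient_group_piM : {morph pi : x y / (x * y)%g}.
Proof. by move=> x y; rewrite [RHS]quot_mul_pi. Qed.
End QuotientTopology.

Section Quaternions.
Variable R : realType.

(* Quat a b c d is a + b e_1 + c e_2 + d e_3, with e_1 e_2 = e_3 *)
Record quat := Quat { q0 : R; q1 : R; q2 : R; q3 : R }.

Definition quat_coords (q : quat) : R * R * R * R := (q0 q, q1 q, q2 q, q3 q).
Definition coords_quat (t : R * R * R * R) : quat :=
  let: (a, b, c, d) := t in Quat a b c d.
Lemma quat_coordsK : cancel quat_coords coords_quat.
Proof. by case. Qed.

HB.instance Definition _ := Choice.copy quat (can_type quat_coordsK).
HB.instance Definition _ := Topological.copy quat (initial_topology quat_coords).

Definition qadd p q :=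
  Quat (q0 p + q0 q) (q1 p + q1 q) (q2 p + q2 q) (q3 p + q3 q).
Definition qopp p := Quat (- q0 p) (- q1 p) (- q2 p) (- q3 p).
Definition qmul p q := Quat
  (q0 p * q0 q - q1 p * q1 q - q2 p * q2 q - q3 p * q3 q)
  (q0 p * q1 q + q1 p * q0 q + q2 p * q3 q - q3 p * q2 q)
  (q0 p * q2 q - q1 p * q3 q + q2 p * q0 q + q3 p * q1 q)
  (q0 p * q3 q + q1 p * q2 q - q2 p * q1 q + q3 p * q0 q).
Definition qscale a p := Quat (a * q0 p) (a * q1 p) (a * q2 p) (a * q3 p).

Local Ltac qring := do ?case=> ? ? ? ?; rewrite /qadd/qopp/qmul/qscale /=; congr Quat; ring.

Fact qaddA : associative qadd. Proof. by qring. Qed.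
Fact qaddC : commutative qadd. Proof. by qring. Qed.
Fact qadd0 : left_id (Quat 0 0 0 0) qadd. Proof. by qring. Qed.
Fact qaddN : left_inverse (Quat 0 0 0 0) qopp qadd. Proof. by qring. Qed.
HB.instance Definition _ := GRing.isZmodule.Build quat qaddA qaddC qadd0 qaddN.

Fact qmulA : associative qmul. Proof. by qring. Qed.
Fact qmul1 : left_id (Quat 1 0 0 0) qmul. Proof. by qring. Qed.
Fact qmulr1 : right_id (Quat 1 0 0 0) qmul. Proof. by qring. Qed.
Fact qmulDl : left_distributive qmul qadd. Proof. by qring. Qed.
Fact qmulDr : right_distributive qmul qadd. Proof. by qring. Qed.
Fact qone_neq0 : Quat 1 0 0 0 != 0 :> quat.
Proof. by apply/eqP => -[/eqP]; rewrite oner_eq0. Qed.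
HB.instance Definition _ := GRing.Zmodule_isNzRing.Build quat
  qmulA qmul1 qmulr1 qmulDl qmulDr qone_neq0.

Fact qscaleA a b p : qscale a (qscale b p) = qscale (a * b) p.
Proof. by case: p => ? ? ? ?; qring. Qed.
Fact qscale1 : left_id 1 qscale. Proof. by move=> [? ? ? ?]; qring. Qed.
Fact qscaleDr : right_distributive qscale +%R.
Proof. by move=> a [? ? ? ?] [? ? ? ?]; congr Quat; rewrite /=; ring. Qed.
Fact qscaleDl p : {morph qscale^~ p : a b / a + b}.
Proof. by move=> a b; case: p => ? ? ? ?; congr Quat; rewrite /=; ring. Qed.
HB.instance Definition _ := GRing.Zmodule_isLmodule.Build R quat
  qscaleA qscale1 qscaleDr qscaleDl.

Definition qconj p := Quat (q0 p) (- q1 p) (- q2 p) (- q3 p).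

Definition qnorm p := Num.sqrt (q0 p ^+ 2 + q1 p ^+ 2 + q2 p ^+ 2 + q3 p ^+ 2).

Definition complexes : set quat := [set Quat x y 0 0 | x in setT & y in setT].

Lemma qnorm1P p : qnorm p = 1 <-> p * qconj p = 1.
Proof.
have E : p * qconj p = Quat (q0 p ^+ 2 + q1 p ^+ 2 + q2 p ^+ 2 + q3 p ^+ 2) 0 0 0.
  by case: p => a b c d; congr Quat => /=; ring.
have s0 : 0 <= q0 p ^+ 2 + q1 p ^+ 2 + q2 p ^+ 2 + q3 p ^+ 2.
  by rewrite !addr_ge0// sqr_ge0.
rewrite E /qnorm; split=> [h|[h]]; last by rewrite h sqrtr1.
by rewrite -[X in Quat X](sqr_sqrtr s0) h expr1n.
Qed.

Lemma qconjM p q : qconj (p * q) = qconj q * qconj p.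
Proof. by case: p q => ? ? ? ? [? ? ? ?]; congr Quat => /=; ring. Qed.

Lemma qconjK : involutive qconj.
Proof. by case=> ? ? ? ?; rewrite /qconj /= !opprK. Qed.

Lemma qnorm1 : qnorm 1 = 1.
Proof. by rewrite /qnorm /= !expr0n /= expr1n !addr0 sqrtr1. Qed.

Lemma qnormM p q : qnorm p = 1 -> qnorm q = 1 -> qnorm (p * q) = 1.
Proof.
move=> /qnorm1P hp /qnorm1P hq; apply/qnorm1P.
by rewrite qconjM mulrA -(mulrA p) hq mulr1.
Qed.

Lemma qnormJ p : qnorm (qconj p) = qnorm p.
Proof. by rewrite /qnorm /= !sqrrN. Qed.

Lemma complexesP p : complexes p <-> q2 p = 0 /\ q3 p = 0.
Proof.
split=> [[x _ [y _ <-]] //|]; case: p => a b c d /= [-> ->].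
by exists a => //; exists b.
Qed.

Lemma complexes1 : complexes 1. Proof. exact/complexesP. Qed.

Lemma complexes0 : complexes 0. Proof. exact/complexesP. Qed.

Lemma complexesM p q : complexes p -> complexes q -> complexes (p * q).
Proof.
move=> /complexesP [a b] /complexesP [c d]; apply/complexesP; split => /=;
  by rewrite a b c d; ring.
Qed.

Lemma complexesD p q : complexes p -> complexes q -> complexes (p + q).
Proof.
by move=> /complexesP [a b] /complexesP [c d]; apply/complexesP;
  split; rewrite /= ?a ?b ?c ?d addr0.
Qed.

Lemma complexesJ p : complexes p -> complexes (qconj p).
Proof. by move=> /complexesP [a b]; apply/complexesP; rewrite /= a b oppr0. Qed.

Definition omega : quat := Quat (- 2^-1) (Num.sqrt 3 / 2) 0 0.

End Quaternions.

Section UnitaryGroups.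
Variable R : realType.
Local Notation H := (quat R).

Definition Sp1 : Type := set_type [set p : H | qnorm p = 1].
HB.instance Definition _ := Topological.copy Sp1 (set_type [set p : H | qnorm p = 1]).

Lemma Sp1P (p : Sp1) : qnorm (val p) = 1.
Proof. by have := valP p; rewrite inE. Qed.
Definition Sp1_of p (h : qnorm p = 1) : Sp1 := SigSub (mem_set h).

Definition Sp1_one := Sp1_of (@qnorm1 R).
Definition Sp1_mul (p q : Sp1) := Sp1_of (qnormM (Sp1P p) (Sp1P q)).
Definition Sp1_inv (p : Sp1) := Sp1_of (etrans (qnormJ (val p)) (Sp1P p)).

Fact Sp1_mulA : associative Sp1_mul.
Proof. by move=> p q r; apply: val_inj; exact: mulrA. Qed.
Fact Sp1_mul1 : left_id Sp1_one Sp1_mul.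
Proof. by move=> p; apply: val_inj; exact: mul1r. Qed.
Fact Sp1_mulr1 : right_id Sp1_one Sp1_mul.
Proof. by move=> p; apply: val_inj; exact: mulr1. Qed.
Fact Sp1_mulrV : right_inverse Sp1_one Sp1_inv Sp1_mul.
Proof. by move=> p; apply: val_inj; apply/qnorm1P/Sp1P. Qed.
Fact Sp1_mulV : left_inverse Sp1_one Sp1_inv Sp1_mul.
Proof.
move=> p; apply: val_inj; rewrite /= -{2}(qconjK (val p)).
by apply/qnorm1P; rewrite qnormJ Sp1P.
Qed.
HB.instance Definition _ := isGroup.Build Sp1
  Sp1_mulA Sp1_mul1 Sp1_mulr1 Sp1_mulV Sp1_mulrV.

Definition U1 : Type := set_type [set p : H | complexes p /\ qnorm p = 1].
HB.instance Definition _ := Topological.copy U1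
  (set_type [set p : H | complexes p /\ qnorm p = 1]).

Lemma U1P (p : U1) : complexes (val p) /\ qnorm (val p) = 1.
Proof. by have := valP p; rewrite inE. Qed.
Definition U1_of p (h : complexes p /\ qnorm p = 1) : U1 := SigSub (mem_set h).

Definition U1_one := U1_of (conj (complexes1 R) (@qnorm1 R)).
Definition U1_mul (p q : U1) :=
  U1_of (conj (complexesM (U1P p).1 (U1P q).1) (qnormM (U1P p).2 (U1P q).2)).
Definition U1_inv (p : U1) :=
  U1_of (conj (complexesJ (U1P p).1) (etrans (qnormJ (val p)) (U1P p).2)).

Fact U1_mulA : associative U1_mul.
Proof. by move=> p q r; apply: val_inj; exact: mulrA. Qed.
Fact U1_mul1 : left_id U1_one U1_mul.
Proof. by move=> p; apply: val_inj; exact: mul1r. Qed.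
Fact U1_mulr1 : right_id U1_one U1_mul.
Proof. by move=> p; apply: val_inj; exact: mulr1. Qed.
Fact U1_mulrV : right_inverse U1_one U1_inv U1_mul.
Proof. by move=> p; apply: val_inj; apply/qnorm1P; exact: (U1P p).2. Qed.
Fact U1_mulV : left_inverse U1_one U1_inv U1_mul.
Proof.
move=> p; apply: val_inj; rewrite /= -{2}(qconjK (val p)).
by apply/qnorm1P; rewrite qnormJ (U1P p).2.
Qed.
HB.instance Definition _ := isGroup.Build U1
  U1_mulA U1_mul1 U1_mulr1 U1_mulV U1_mulrV.

Definition adjmx m n (A : 'M[H]_(m, n)) : 'M[H]_(n, m) := (map_mx (@qconj R) A)^T.

(* M(n, C) is realised inside M(n, H) *)
Definition unitary n (A : 'M[H]_n) : Prop :=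
  (forall i j, complexes (A i j)) /\ adjmx A *m A = 1%:M.

Lemma adjmxM m n p (A : 'M[H]_(m, n)) (B : 'M[H]_(n, p)) :
  adjmx (A *m B) = adjmx B *m adjmx A.
Proof.
apply/matrixP=> i j; rewrite !mxE.
have -> : @qconj R (\sum_k A j k * B k i) = \sum_k qconj (A j k * B k i).
  apply: (big_morph (@qconj R)) => [[? ? ? ?] [? ? ? ?]|].
    by congr Quat => /=; ring.
  by congr Quat => /=; rewrite oppr0.
by apply: eq_bigr => k _; rewrite qconjM !mxE.
Qed.

Lemma adjmxK m n (A : 'M[H]_(m, n)) : adjmx (adjmx A) = A.
Proof. by apply/matrixP=> i j; rewrite !mxE qconjK. Qed.

Lemma complexes_mulmx n (A B : 'M[H]_n) :
  (forall i j, complexes (A i j)) -> (forall i j, complexes (B i j)) ->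
  forall i j, complexes ((A *m B) i j).
Proof.
move=> hA hB i j; rewrite mxE; apply: (big_ind (@complexes R)).
- exact: complexes0.
- exact: complexesD.
- by move=> k _; exact: complexesM.
Qed.

Definition quat_of_complex (z : complex.complex R) : H :=
  Quat (complex.Re z) (complex.Im z) 0 0.

Lemma quat_of_complexE n (A : 'M[H]_n) : (forall i j, complexes (A i j)) ->
  A = map_mx quat_of_complex
        (map_mx (fun q : H => complex.Complex (q0 q) (q1 q)) A).
Proof.
move=> hA; apply/matrixP=> i j; rewrite !mxE.
by have /complexesP := hA i j; case: (A i j) => a b c d /= [-> ->].
Qed.

Lemma quat_of_complex_mulmx n (A B : 'M[complex.complex R]_n) :
  map_mx quat_of_complex (A *m B) =
  map_mx quat_of_complex A *m map_mx quat_of_complex B.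
Proof.
apply/matrixP=> i j; rewrite !mxE (big_morph quat_of_complex (id1 := 0) (op1 := +%R)).
- apply: eq_bigr => k _; rewrite !mxE.
  by case: (A i k) (B k j) => ? ? [? ?]; congr Quat => /=; ring.
- by case=> ? ? [? ?]; congr Quat => /=; rewrite addr0.
- by [].
Qed.

Lemma quat_of_complex1 n : map_mx quat_of_complex 1%:M = 1%:M :> 'M[H]_n.
Proof. by apply/matrixP=> i j; rewrite !mxE; case: (i == j). Qed.

Lemma quat_of_complex_inj n (A B : 'M[complex.complex R]_n) :
  map_mx quat_of_complex A = map_mx quat_of_complex B -> A = B.
Proof.
move=> /matrixP h; apply/matrixP=> i j; have := h i j; rewrite !mxE.
by case: (A i j) (B i j) => ? ? [? ?] [] /= -> ->.
Qed.

Lemma unitary_adjmx n (A : 'M[H]_n) : unitary A -> A *m adjmx A = 1%:M.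
Proof.
move=> [hA h]; have hA' i j : complexes (adjmx A i j).
  by rewrite !mxE; exact: complexesJ.
move: (adjmx A) hA' h => B hB; rewrite (quat_of_complexE hA) (quat_of_complexE hB).
rewrite -!quat_of_complex_mulmx -quat_of_complex1.
by move=> /quat_of_complex_inj /mulmx1C ->.
Qed.

Variable n : nat.

Definition U : Type := set_type [set A : 'M[H]_n | unitary A].
HB.instance Definition _ := Topological.copy U (set_type [set A : 'M[H]_n | unitary A]).

Lemma UP (A : U) : unitary (val A).
Proof. by have := valP A; rewrite inE. Qed.
Definition U_of A (h : unitary A) : U := SigSub (mem_set h).

Fact unitary1 : unitary (1%:M : 'M[H]_n).
Proof.
split=> [i j|]; first by rewrite mxE; case: (i == j);
  [exact: complexes1 | exact: complexes0].
rewrite mulmx1; apply/matrixP=> i j; rewrite !mxE eq_sym.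
by case: (i == j); congr Quat => /=; rewrite oppr0.
Qed.

Fact unitaryM (A B : 'M[H]_n) : unitary A -> unitary B -> unitary (A *m B).
Proof.
move=> [hA uA] [hB uB]; split; first exact: complexes_mulmx.
by rewrite adjmxM mulmxA -(mulmxA (adjmx B)) uA mulmx1.
Qed.

Fact unitaryJ (A : 'M[H]_n) : unitary A -> unitary (adjmx A).
Proof.
move=> uA; split; last by rewrite adjmxK unitary_adjmx.
by move=> i j; rewrite !mxE; apply: complexesJ; case: uA.
Qed.

Definition U_one := U_of unitary1.
Definition U_mul (A B : U) := U_of (unitaryM (UP A) (UP B)).
Definition U_inv (A : U) := U_of (unitaryJ (UP A)).

Fact U_mulA : associative U_mul.
Proof. by move=> A B C; apply: val_inj; exact: mulmxA. Qed.
Fact U_mul1 : left_id U_one U_mul.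
Proof. by move=> A; apply: val_inj; exact: mul1mx. Qed.
Fact U_mulr1 : right_id U_one U_mul.
Proof. by move=> A; apply: val_inj; exact: mulmx1. Qed.
Fact U_mulrV : right_inverse U_one U_inv U_mul.
Proof. by move=> A; apply: val_inj; apply: unitary_adjmx; exact: UP. Qed.
Fact U_mulV : left_inverse U_one U_inv U_mul.
Proof. by move=> A; apply: val_inj; exact: (UP A).2. Qed.
HB.instance Definition _ := isGroup.Build U
  U_mulA U_mul1 U_mulr1 U_mulV U_mulrV.

End UnitaryGroups.

Section Z2.
Variable R : realType.
Definition U1_Sp1_U2 : groupTopologyType := (U1 R * Sp1 R * U R 2)%type.
Local Notation G := U1_Sp1_U2.

Fact U1_m1 : complexes (-1 : quat R) /\ qnorm (-1 : quat R) = 1.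
Proof.
split; first by apply/complexesP; rewrite /= oppr0.
by rewrite /qnorm /= oppr0 sqrrN expr0n /= expr1n !addr0 sqrtr1.
Qed.

Fact unitary_m1 : unitary (- 1%:M : 'M[quat R]_2).
Proof.
split=> [i j|].
  by have /complexesP [a b] := (unitary1 R 2).1 i j; apply/complexesP;
    rewrite !mxE /= in a b *; rewrite a b oppr0.
have -> : adjmx (- 1%:M : 'M[quat R]_2) = - adjmx 1%:M.
  by apply/matrixP=> i j; rewrite !mxE; case: (_ == _); congr Quat.
by rewrite mulNmx mulmxN opprK (unitary1 R 2).2.
Qed.

Definition Z2_set : set G :=
  [set (1%g, 1%g, 1%g); (U1_of U1_m1, Sp1_of U1_m1.2, U_of unitary_m1)].

Local Notation mone := ((U1_of U1_m1, Sp1_of U1_m1.2, U_of unitary_m1) : G).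

Fact moneM : (mone * mone)%g = 1%g.
Proof.
congr (_, _, _); apply: val_inj; rewrite /=.
- by rewrite mulrNN mulr1.
- by rewrite mulrNN mulr1.
- by rewrite mulNmx mulmxN opprK mulmx1.
Qed.

Fact moneC (x : G) : (mone * x)%g = (x * mone)%g.
Proof.
case: x => [[a b] c]; congr (_, _, _); apply: val_inj; rewrite /=.
- by rewrite mulN1r mulrN1.
- by rewrite mulN1r mulrN1.
- by rewrite mulNmx mulmxN mulmx1 mul1mx.
Qed.

Fact Z2_1 : Z2_set 1%g. Proof. by left. Qed.
Fact Z2_M x y : Z2_set x -> Z2_set y -> Z2_set (x * y)%g.
Proof.
move=> [->|->] [->|->]; first by left; exact: mulg1.
- by right; exact: mul1g.
- by right; exact: mulg1.
- by left; exact: moneM.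
Qed.
Fact Z2_V x : Z2_set x -> Z2_set (x^-1)%g.
Proof.
move=> [->|->]; first by left; exact: invg1.
by right; apply: mulg1_eq; exact: moneM.
Qed.
Fact Z2_J x y : Z2_set x -> Z2_set (x ^ y)%g.
Proof.
move=> [->|->]; first by left; exact: conj1g.
by right; rewrite conjgE moneC mulKg.
Qed.

Definition Z2 : normal_subgroup G :=
  @NormalSubgroup _ (Subgroup Z2_1 Z2_M Z2_V) Z2_J.

End Z2.

Section Cayley.
Variable R : realType.
Local Notation H := (quat R).

(* Cay m n is m + n e_4 *)
Record cayley := Cay { cay1 : H; cay2 : H }.

Definition cayley_coords (x : cayley) : H * H := (cay1 x, cay2 x).
Definition coords_cayley (t : H * H) : cayley := Cay t.1 t.2.
Lemma cayley_coordsK : cancel cayley_coords coords_cayley.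
Proof. by case. Qed.

HB.instance Definition _ := Choice.copy cayley (can_type cayley_coordsK).
HB.instance Definition _ :=
  Topological.copy cayley (initial_topology cayley_coords).

Definition cadd x y := Cay (cay1 x + cay1 y) (cay2 x + cay2 y).
Definition copp x := Cay (- cay1 x) (- cay2 x).
Definition cscale a x := Cay (a *: cay1 x) (a *: cay2 x).

Fact caddA : associative cadd.
Proof. by move=> x y z; congr Cay; exact: addrA. Qed.
Fact caddC : commutative cadd.
Proof. by move=> x y; congr Cay; exact: addrC. Qed.
Fact cadd0 : left_id (Cay 0 0) cadd.
Proof. by case=> m n; congr Cay; exact: add0r. Qed.
Fact caddN : left_inverse (Cay 0 0) copp cadd.
Proof. by move=> x; congr Cay; exact: addNr. Qed.
HB.instance Definition _ := GRing.isZmodule.Build cayley caddA caddC cadd0 caddN.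

Fact cscaleA a b x : cscale a (cscale b x) = cscale (a * b) x.
Proof. by rewrite /cscale /= !scalerA. Qed.
Fact cscale1 : left_id 1 cscale.
Proof. by case=> m n; congr Cay; exact: scale1r. Qed.
Fact cscaleDr : right_distributive cscale +%R.
Proof. by move=> a x y; congr Cay; exact: scalerDr. Qed.
Fact cscaleDl x : {morph cscale^~ x : a b / a + b}.
Proof. by move=> a b; congr Cay; exact: scalerDl. Qed.
HB.instance Definition _ := GRing.Zmodule_isLmodule.Build R cayley
  cscaleA cscale1 cscaleDr cscaleDl.

Definition cmul x y :=
  let: Cay m n := x in let: Cay p q := y in
  Cay (m * p - qconj q * n) (n * qconj p + q * m).
Definition cconj x := Cay (qconj (cay1 x)) (- cay2 x).

Definition cayley_of_quat (q : H) := Cay q 0.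
Definition cayley_of_real (a : R) := cayley_of_quat (Quat a 0 0 0).

End Cayley.

Section Jordan.
Variable R : realType.
Local Notation C := (cayley R).
Local Notation i0 := (@Ordinal 3 0 isT).
Local Notation i1 := (@Ordinal 3 1 isT).
Local Notation i2 := (@Ordinal 3 2 isT).

Definition hermitian (X : 'M[C]_3) : bool := (map_mx (@cconj R) X)^T == X.

Record jordan := Jordan { jordan_mx :> 'M[C]_3; jordanP : hermitian jordan_mx }.
HB.instance Definition _ := [isSub for jordan_mx].
HB.instance Definition _ := [Choice of jordan by <:].
HB.instance Definition _ := Topological.copy jordan (initial_topology jordan_mx).

Lemma hermitianP (X : 'M[C]_3) :
  reflect (forall i j, cconj (X j i) = X i j) (hermitian X).
Proof.
apply: (iffP eqP) => [/matrixP h i j|h]; first by have := h i j; rewrite !mxE.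
by apply/matrixP=> i j; rewrite !mxE.
Qed.

Lemma jordanE (X : jordan) i j : cconj (X j i) = X i j.
Proof. by apply/hermitianP; case: X. Qed.

Lemma jordan_inj (X Y : jordan) : (forall i j, X i j = Y i j) -> X = Y.
Proof. by move=> h; apply: val_inj; exact/matrixP. Qed.

Fact cconjD : {morph @cconj R : x y / x + y}.
Proof.
by move=> [[? ? ? ?] [? ? ? ?]] [[? ? ? ?] [? ? ? ?]];
  congr Cay; congr Quat => /=; ring.
Qed.
Fact cconjN : {morph @cconj R : x / - x}.
Proof. by move=> [[? ? ? ?] [? ? ? ?]]; congr Cay; congr Quat => /=; ring. Qed.
Fact cconj0 : cconj 0 = 0 :> C.
Proof. by congr Cay; congr Quat; rewrite /= oppr0. Qed.
Fact cconjZ a : {morph @cconj R : x / a *: x}.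
Proof. by move=> [[? ? ? ?] [? ? ? ?]]; congr Cay; congr Quat => /=; ring. Qed.
Fact cconjM (x y : C) : cconj (cmul x y) = cmul (cconj y) (cconj x).
Proof.
by case: x y => [[? ? ? ?] [? ? ? ?]] [[? ? ? ?] [? ? ? ?]];
  congr Cay; congr Quat => /=; ring.
Qed.
Fact cconjK : involutive (@cconj R).
Proof. by move=> [m n]; rewrite /cconj /= opprK qconjK. Qed.

Fact hermitianD (X Y : jordan) : hermitian (jordan_mx X + jordan_mx Y).
Proof. by apply/hermitianP=> i j; rewrite !mxE cconjD !jordanE. Qed.
Fact hermitianN (X : jordan) : hermitian (- jordan_mx X).
Proof. by apply/hermitianP=> i j; rewrite !mxE cconjN !jordanE. Qed.
Fact hermitian0 : hermitian 0.
Proof. by apply/hermitianP=> i j; rewrite !mxE cconj0. Qed.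

Definition jzero := Jordan hermitian0.
Definition jadd (X Y : jordan) := Jordan (hermitianD X Y).
Definition jopp (X : jordan) := Jordan (hermitianN X).

Fact jaddA : associative jadd.
Proof. by move=> X Y Z; apply: val_inj; exact: addrA. Qed.
Fact jaddC : commutative jadd.
Proof. by move=> X Y; apply: val_inj; exact: addrC. Qed.
Fact jadd0 : left_id jzero jadd.
Proof. by move=> X; apply: val_inj; exact: add0r. Qed.
Fact jaddN : left_inverse jzero jopp jadd.
Proof. by move=> X; apply: val_inj; exact: addNr. Qed.
HB.instance Definition _ := GRing.isZmodule.Build jordan jaddA jaddC jadd0 jaddN.

Fact hermitianZ a (X : jordan) : hermitian (map_mx ( *:%R a) (jordan_mx X)).
Proof. by apply/hermitianP=> i j; rewrite !mxE cconjZ jordanE. Qed.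
Definition jscale a (X : jordan) := Jordan (hermitianZ a X).

Fact jscaleA a b X : jscale a (jscale b X) = jscale (a * b) X.
Proof. by apply: jordan_inj => i j; rewrite !mxE scalerA. Qed.
Fact jscale1 : left_id 1 jscale.
Proof. by move=> X; apply: jordan_inj => i j; rewrite !mxE scale1r. Qed.
Fact jscaleDr : right_distributive jscale +%R.
Proof. by move=> a X Y; apply: jordan_inj => i j; rewrite !mxE scalerDr. Qed.
Fact jscaleDl X : {morph jscale^~ X : a b / a + b}.
Proof. by move=> a b; apply: jordan_inj => i j; rewrite !mxE scalerDl. Qed.
HB.instance Definition _ := GRing.Zmodule_isLmodule.Build R jordan
  jscaleA jscale1 jscaleDr jscaleDl.

(* cayley R is not associative, hence not a ring: *m is not available *)
Definition cmulmx (X Y : 'M[C]_3) : 'M[C]_3 :=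
  \matrix_(i, j) \sum_k cmul (X i k) (Y k j).

Fact hermitianM (X Y : jordan) :
  hermitian (map_mx ( *:%R (2^-1 : R)) (cmulmx X Y + cmulmx Y X)).
Proof.
have E (A B : jordan) i j :
    cconj (\sum_k cmul (A j k) (B k i)) = \sum_k cmul (B i k) (A k j).
  rewrite (big_morph (@cconj R) cconjD cconj0).
  by apply: eq_bigr => k _; rewrite cconjM !jordanE.
by apply/hermitianP=> i j; rewrite !mxE cconjZ cconjD !E addrC.
Qed.

Definition jmul (X Y : jordan) : jordan := Jordan (hermitianM X Y).

Definition jordan_matrix (xi1 xi2 xi3 : R) (x1 x2 x3 : C) : 'M[C]_3 :=
  \matrix_(i, j)
    match val i, val j with
    | 0%N, 0%N => cayley_of_real xi1 | 0%N, 1%N => x3 | 0%N, _ => cconj x2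
    | 1%N, 0%N => cconj x3 | 1%N, 1%N => cayley_of_real xi2 | 1%N, _ => x1
    | _, 0%N => x2 | _, 1%N => cconj x1 | _, _ => cayley_of_real xi3
    end.

Fact jordan_matrix_hermitian xi1 xi2 xi3 x1 x2 x3 :
  hermitian (jordan_matrix xi1 xi2 xi3 x1 x2 x3).
Proof.
have r a : cconj (cayley_of_real a) = cayley_of_real a :> C.
  by congr Cay; [congr Quat|congr Quat]; rewrite /= oppr0.
by apply/hermitianP=> -[[|[|[|//]]] hi] [[|[|[|//]]] hj]; rewrite !mxE /= ?cconjK ?r.
Qed.

Definition mkjordan xi1 xi2 xi3 x1 x2 x3 :=
  Jordan (jordan_matrix_hermitian xi1 xi2 xi3 x1 x2 x3).

Definition jxi1 (X : jordan) : R := q0 (cay1 (X i0 i0)).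
Definition jxi2 (X : jordan) : R := q0 (cay1 (X i1 i1)).
Definition jxi3 (X : jordan) : R := q0 (cay1 (X i2 i2)).
Definition jx1 (X : jordan) : C := X i1 i2.
Definition jx2 (X : jordan) : C := X i2 i0.
Definition jx3 (X : jordan) : C := X i0 i1.

Lemma mkjordanE (X : jordan) :
  X = mkjordan (jxi1 X) (jxi2 X) (jxi3 X) (jx1 X) (jx2 X) (jx3 X).
Proof.
have r i : X i i = cayley_of_real (q0 (cay1 (X i i))).
  have := jordanE X i i; case: (X i i) => [[a b c d] [e f g h]] [] /=.
  have z (t : R) : - t = t -> t = 0 by move=> ?; lra.
  by do 7! move=> /z ->.
apply: jordan_inj => i j; rewrite mxE.
case: i => [[|[|[|//]]] hi]; case: j => [[|[|[|//]]] hj] /=;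
  rewrite (bool_irrelevance hi isT) (bool_irrelevance hj isT) ?jordanE //;
  exact: r.
Qed.

Definition jordan_map (f1 f2 f3 : C -> C) (X : jordan) : jordan :=
  mkjordan (jxi1 X) (jxi2 X) (jxi3 X) (f1 (jx1 X)) (f2 (jx2 X)) (f3 (jx3 X)).

Definition cdot (x y : C) : R := q0 (cay1 (cmul x (cconj y))).

Lemma jmulE a1 a2 a3 x1 x2 x3 b1 b2 b3 y1 y2 y3 :
  jmul (mkjordan a1 a2 a3 x1 x2 x3) (mkjordan b1 b2 b3 y1 y2 y3) =
  mkjordan (a1 * b1 + cdot x2 y2 + cdot x3 y3)
           (a2 * b2 + cdot x3 y3 + cdot x1 y1)
           (a3 * b3 + cdot x1 y1 + cdot x2 y2)
    (2^-1 *: ((a2 + a3) *: y1 + (b2 + b3) *: x1 + cconj (cmul x2 y3 + cmul y2 x3)))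
    (2^-1 *: ((a3 + a1) *: y2 + (b3 + b1) *: x2 + cconj (cmul x3 y1 + cmul y3 x1)))
    (2^-1 *: ((a1 + a2) *: y3 + (b1 + b2) *: x3 + cconj (cmul x1 y2 + cmul y1 x2))).
Proof.
rewrite [LHS]mkjordanE /mkjordan; apply: val_inj => /=.
rewrite /jxi1 /jxi2 /jxi3 /jx1 /jx2 /jx3 /= !mxE !big_ord_recl !big_ord0 !mxE /=.
rewrite /cdot.
case: x1 x2 x3 => [[? ? ? ?] [? ? ? ?]] [[? ? ? ?] [? ? ? ?]] [[? ? ? ?] [? ? ? ?]].
case: y1 y2 y3 => [[? ? ? ?] [? ? ? ?]] [[? ? ? ?] [? ? ? ?]] [[? ? ? ?] [? ? ? ?]].
congr jordan_matrix; rewrite /=; try (congr Cay; congr Quat); rewrite /=; by field.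
Qed.

Definition F4_set : set (jordan -> jordan) :=
  [set alpha | [/\ linear alpha, bijective alpha &
                   forall X Y, alpha (jmul X Y) = jmul (alpha X) (alpha Y)]].

Lemma jordan_map_F4 (f1 f2 f3 g1 g2 g3 : C -> C) :
  linear f1 -> linear f2 -> linear f3 ->
  cancel f1 g1 -> cancel f2 g2 -> cancel f3 g3 ->
  cancel g1 f1 -> cancel g2 f2 -> cancel g3 f3 ->
  (forall x y, cdot (f1 x) (f1 y) = cdot x y) ->
  (forall x y, cdot (f2 x) (f2 y) = cdot x y) ->
  (forall x y, cdot (f3 x) (f3 y) = cdot x y) ->
  (forall x y, cconj (cmul (f2 x) (f3 y)) = f1 (cconj (cmul x y))) ->
  (forall x y, cconj (cmul (f3 x) (f1 y)) = f2 (cconj (cmul x y))) ->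
  (forall x y, cconj (cmul (f1 x) (f2 y)) = f3 (cconj (cmul x y))) ->
  F4_set (jordan_map f1 f2 f3).
Proof.
move=> l1 l2 l3 c1 c2 c3 d1 d2 d3 o1 o2 o3 t1 t2 t3.
have lD (f : C -> C) (l : linear f) : {morph f : x y / x + y :> C}.
  by move=> x y; have := l 1 x y; rewrite !scale1r.
have l0 (f : C -> C) (l : linear f) : f 0 = 0 :> C.
  by apply: (addrI (f 0)); rewrite -(lD f l) !addr0.
have lZ (f : C -> C) (l : linear f) a : {morph f : x / a *: x :> C}.
  by move=> x; have := l a x 0; rewrite (l0 f l) !addr0.
split.
- move=> a X Y; apply: jordan_inj => i j.
  rewrite (mkjordanE (a *: X + Y)) !mxE.
  rewrite /jxi1 /jxi2 /jxi3 /jx1 /jx2 /jx3 !mxE ?l1 ?l2 ?l3.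
  have rr (u v : C) : cayley_of_real (q0 (cay1 (a *: u + v))) =
     a *: cayley_of_real (q0 (cay1 u)) + cayley_of_real (q0 (cay1 v)).
    by congr Cay; congr Quat => /=; ring.
  case: i => [[|[|[|//]]] hi]; case: j => [[|[|[|//]]] hj] /=;
    by rewrite ?mxE ?rr ?cconjD ?cconjZ.
- exists (jordan_map g1 g2 g3) => X; rewrite [RHS]mkjordanE /jordan_map;
  rewrite /jxi1 /jxi2 /jxi3 /jx1 /jx2 /jx3 !mxE /=.
  + by rewrite c1 c2 c3.
  + by rewrite d1 d2 d3.
- have E a1 a2 a3 x1 x2 x3 : jordan_map f1 f2 f3 (mkjordan a1 a2 a3 x1 x2 x3) =
      mkjordan a1 a2 a3 (f1 x1) (f2 x2) (f3 x3).
    by rewrite /jordan_map /jxi1 /jxi2 /jxi3 /jx1 /jx2 /jx3 !mxE /=.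
  move=> X Y; rewrite (mkjordanE X) (mkjordanE Y) jmulE !E jmulE.
  rewrite !o1 !o2 !o3 (lZ f1 l1) (lZ f2 l2) (lZ f3 l3).
rewrite !(lD f1 l1) !(lD f2 l2) !(lD f3 l3) !(lZ f1 l1) !(lZ f2 l2) !(lZ f3 l3).
by rewrite !cconjD !(lD f1 l1) !(lD f2 l2) !(lD f3 l3) !t1 !t2 !t3.
Qed.

Definition F4 : Type := set_type F4_set.
HB.instance Definition _ := Choice.copy F4 (set_type F4_set).
(* topology of pointwise convergence, i.e. the usual one as jordan is
   finite-dimensional *)
HB.instance Definition _ := Topological.copy F4
  (initial_topology (fun alpha : F4 => (val alpha : {ptws jordan -> jordan}))).

Definition F4_of alpha (h : F4_set alpha) : F4 := SigSub (mem_set h).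
Lemma F4P (alpha : F4) : F4_set (val alpha).
Proof. by have := valP alpha; rewrite inE. Qed.

Fact F4_set1 : F4_set id.
Proof. by split=> //; exists id. Qed.
Fact F4_setM f g : F4_set f -> F4_set g -> F4_set (f \o g).
Proof.
move=> [lf bf mf] [lg bg mg]; split=> [a X Y||X Y] /=.
- by rewrite lg lf.
- exact: bij_comp.
- by rewrite mg mf.
Qed.

Lemma F4_bij (alpha : F4) : {g | cancel (val alpha) g /\ cancel g (val alpha)}.
Proof.
by apply: cid; case: (F4P alpha) => _ [g c d] _; exists g.
Qed.

Fact F4_setV (alpha : F4) : F4_set (sval (F4_bij alpha)).
Proof.
case: (F4_bij alpha) => g [c d] /=; case: (F4P alpha) => l b m.
split=> [a X Y||X Y].
- by apply: (can_inj c); rewrite l !d.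
- by exists (val alpha).
- by apply: (can_inj c); rewrite m !d.
Qed.

Definition F4_one : F4 := F4_of F4_set1.
Definition F4_mul (alpha beta : F4) : F4 := F4_of (F4_setM (F4P alpha) (F4P beta)).
Definition F4_inv (alpha : F4) : F4 := F4_of (F4_setV alpha).

Fact F4_mulA : associative F4_mul.
Proof. by move=> f g h; exact: val_inj. Qed.
Fact F4_mul1 : left_id F4_one F4_mul.
Proof. by move=> f; exact: val_inj. Qed.
Fact F4_mulr1 : right_id F4_one F4_mul.
Proof. by move=> f; exact: val_inj. Qed.
Fact F4_mulV : left_inverse F4_one F4_inv F4_mul.
Proof.
move=> f; apply: val_inj; apply/funext => X.
exact: (svalP (F4_bij f)).1 X.
Qed.
Fact F4_mulrV : right_inverse F4_one F4_inv F4_mul.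
Proof.
move=> f; apply: val_inj; apply/funext => X.
exact: (svalP (F4_bij f)).2 X.
Qed.
HB.instance Definition _ := isGroup.Build F4
  F4_mulA F4_mul1 F4_mulr1 F4_mulV F4_mulrV.

Section Fixed.
Variable g : F4.
Definition F4_fixed_set : set F4 := [set alpha : F4 | (g^-1 * alpha * g)%g = alpha].

Fact F4_fixedP alpha : F4_fixed_set alpha <-> (alpha ^ g)%g = alpha.
Proof. by rewrite /F4_fixed_set /= conjgE mulgA. Qed.
Fact F4_fixed1 : F4_fixed_set 1%g.
Proof. by apply/F4_fixedP; exact: conj1g. Qed.
Fact F4_fixedM x y : F4_fixed_set x -> F4_fixed_set y -> F4_fixed_set (x * y)%g.
Proof. by move=> /F4_fixedP hx /F4_fixedP hy; apply/F4_fixedP; rewrite conjMg hx hy. Qed.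
Fact F4_fixedV x : F4_fixed_set x -> F4_fixed_set (x^-1)%g.
Proof. by move=> /F4_fixedP hx; apply/F4_fixedP; rewrite conjVg hx. Qed.

Definition F4_fixed : subgroup F4 := Subgroup F4_fixed1 F4_fixedM F4_fixedV.
End Fixed.

Definition gamma3_cayley (w : quat R) (x : C) : C := Cay (cay1 x) (w * cay2 x).

Definition sigma3_cayley1 (w : quat R) (x : C) : C :=
  cmul (cmul (cayley_of_quat (qconj w)) x) (cayley_of_quat (qconj w)).
Definition sigma3_cayley2 (w : quat R) (x : C) : C := cmul (cayley_of_quat w) x.
Definition sigma3_cayley3 (w : quat R) (x : C) : C := cmul x (cayley_of_quat w).

Fact omega_norm : (q0 (omega R)) ^+ 2 + (q1 (omega R)) ^+ 2 = 1.
Proof.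
by rewrite /= exprMn sqr_sqrtr ?ler0n //; field.
Qed.

Local Ltac cayring h :=
  do ?case=> [[? ? ? ?] [? ? ? ?]];
  rewrite /gamma3_cayley /sigma3_cayley1 /sigma3_cayley2 /sigma3_cayley3
    /cdot /cmul /cconj /cayley_of_quat /=;
  try (congr Cay; congr Quat); rewrite /=; ring: h.

Fact gamma3_F4 : F4_set (jordan_map (gamma3_cayley (omega R))
  (gamma3_cayley (omega R)) (gamma3_cayley (omega R))).
Proof.
move: omega_norm; rewrite /omega; move: (- 2^-1) (Num.sqrt 3 / 2) => a b /= h.
have {}h : b ^+ 2 = 1 - a ^+ 2 by rewrite -h; ring.
have l w : linear (gamma3_cayley w) by move=> c; move: w => [? ? ? ?]; cayring h.
apply: (@jordan_map_F4 _ _ _ (gamma3_cayley (Quat a (- b) 0 0))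
  (gamma3_cayley (Quat a (- b) 0 0)) (gamma3_cayley (Quat a (- b) 0 0)));
  try exact: l; cayring h.
Qed.

Fact cayley_unitE (a b : R) : b ^+ 2 = 1 - a ^+ 2 ->
  let w := cayley_of_quat (Quat a b 0 0) in
  let w' := cayley_of_quat (Quat a (- b) 0 0) in
  [/\ forall x : C, cmul w' (cmul w x) = x,
      forall x : C, cmul (cmul x w) w' = x,
      forall x : C, cmul (cmul w' x) w' = cmul w' (cmul x w'),
      forall x y : C, cdot (cmul w x) (cmul w y) = cdot x y &
      forall x y : C, cdot (cmul x w) (cmul y w) = cdot x y].
Proof.
move=> h w w'; rewrite /w /w'; split; cayring h.
Qed.


Fact cayley_moufang (a b : R) (x y : C) :
  let w := cayley_of_quat (Quat a b 0 0) in
  [/\ cmul (cmul w x) (cmul y w) = cmul (cmul w (cmul x y)) w,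
      cmul x (cmul (cmul w y) w) = cmul (cmul (cmul x w) y) w &
      cmul (cmul (cmul w x) w) y = cmul w (cmul x (cmul w y))].
Proof.
move: x y => [[? ? ? ?] [? ? ? ?]] [[? ? ? ?] [? ? ? ?]].
rewrite /cayley_of_quat /cmul /=; split; congr Cay; congr Quat; rewrite /=; ring.
Qed.
Fact sigma3_F4 : F4_set (jordan_map (sigma3_cayley1 (omega R))
  (sigma3_cayley2 (omega R)) (sigma3_cayley3 (omega R))).
Proof.
move: omega_norm; rewrite /omega; move: (- 2^-1) (Num.sqrt 3 / 2) => a b /= h.
have {}h : b ^+ 2 = 1 - a ^+ 2 by rewrite -h; ring.
have h' : (- b) ^+ 2 = 1 - a ^+ 2 by rewrite sqrrN.
have [LL RR LRA dL dR] := cayley_unitE h.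
have := cayley_unitE h'; rewrite opprK /= => -[LL' RR' LRA' dL' dR'].
have cw : cconj (cayley_of_quat (Quat a b 0 0)) = cayley_of_quat (Quat a (- b) 0 0) :> C.
  by congr Cay; [congr Quat|]; rewrite oppr0.
have cw' : cconj (cayley_of_quat (Quat a (- b) 0 0)) = cayley_of_quat (Quat a b 0 0) :> C.
  by rewrite -cw cconjK.
have qw : qconj (Quat a b 0 0) = Quat a (- b) 0 0 by rewrite /qconj /= oppr0.
apply: (@jordan_map_F4 _ _ _ (sigma3_cayley1 (Quat a (- b) 0 0))
  (sigma3_cayley2 (Quat a (- b) 0 0)) (sigma3_cayley3 (Quat a (- b) 0 0)));
  rewrite /sigma3_cayley1 /sigma3_cayley2 /sigma3_cayley3 ?qw;
  try (have -> : qconj (Quat a (- b) 0 0) = Quat a b 0 0 by rewrite -qw qconjK).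
- move=> c; cayring h.
- move=> c; cayring h.
- move=> c; cayring h.
- by move=> x; rewrite LRA' RR' LL'.
- exact: LL.
- exact: RR.
- by move=> x; rewrite LRA RR LL.
- exact: LL'.
- exact: RR'.
- by move=> x y; rewrite dR' dL'.
- exact: dL.
- exact: dR.
- move=> x y; have [-> _ _] := cayley_moufang a b x y.
  by rewrite !cconjM cw LRA.
- move=> x y; have [_ -> _] := cayley_moufang a (- b)
    (cmul x (cayley_of_quat (Quat a b 0 0))) y.
  by rewrite RR cconjM cw'.
- move=> x y; have [_ _ ->] := cayley_moufang a (- b) x
    (cmul (cayley_of_quat (Quat a b 0 0)) y).
  by rewrite LL cconjM cw'.
Qed.

Definition gamma3 : F4 := F4_of gamma3_F4.
Definition sigma3 : F4 := F4_of sigma3_F4.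

End Jordan.

(* Main.v *)
(* Write an element of J as a pair (M, n) of a hermitian quaternionic matrix M and a row n
   of three quaternions, the e4-parts of x1, x2, x3.  For p in Sp(1) and A in Sp(3) the map
   (M, n) |-> (A M A^-1, p n A^-1) belongs to F4; gamma_3 is the map of (w, E) and sigma_3 that
   of (1, diag(1, w^bar, w)), whose centraliser in U(1) x Sp(3) is U(1) x Sp(1) x U(2).  This
   gives a homomorphism phi onto part of the fixed group, with kernel Z_2.

   It is onto: an automorphism al fixed by both elements preserves the common fixed space of
   gamma_3 and sigma_3, which is R + Herm(2, C), hence it fixes the idempotent E1 and, after
   multiplication by an element of U(2), also E2 and E3.  Then al is a triple (f1, f2, f3) of
   isometries of the Cayley algebra related by triality.  Normalising f1 1 = f2 1 = 1 makes
   f1 = f2 = f3 an automorphism of the Cayley algebra fixing e1 and mapping e2 to c e2 and e4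
   to r e4 with c, r in U(1); writing c = s^2, this is the image of (r s, s, diag(s, s^bar)).

   Finally a continuous bijection from a quotient of a compact group onto a Hausdorff group
   is a homeomorphism. *)
From HB Require Import structures.
Require Import Defs.
From mathcomp Require Import all_boot all_order all_algebra.
From mathcomp Require Import ring lra.
From mathcomp Require Import all_classical all_reals all_analysis.

Set Implicit Arguments.
Unset Strict Implicit.
Unset Printing Implicit Defensive.

Import Order.TTheory GRing.Theory Num.Theory.
Import numFieldNormedType.Exports.

Local Open Scope classical_set_scope.
Local Open Scope ring_scope.

Local Notation i0 := (@Ordinal 3 0 isT).
Local Notation i1 := (@Ordinal 3 1 isT).
Local Notation i2 := (@Ordinal 3 2 isT).
Local Notation j0 := (@Ordinal 2 0 isT).
Local Notation j1 := (@Ordinal 2 1 isT).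

(** * The exceptional Jordan algebra as Herm(3, H) + H^3 *)

Section MatrixModel.
Variable R : realType.
Local Notation H := (quat R).
Local Notation C := (cayley R).
Local Notation J := (jordan R).

Lemma ord3P (P : 'I_3 -> Prop) : P i0 -> P i1 -> P i2 -> forall i, P i.
Proof.
move=> h0 h1 h2 [[|[|[|//]]] hi]; first by rewrite (bool_irrelevance hi isT).
  by rewrite (bool_irrelevance hi isT).
by rewrite (bool_irrelevance hi isT).
Qed.

Definition jH (X : J) : 'M[H]_3 := map_mx (@cay1 R) X.
Definition jN (X : J) : 'rV[H]_3 :=
  \row_j cay2 (match val j with 0%N => jx1 X | 1%N => jx2 X | _ => jx3 X end).
(** Only the real parts of the diagonal and one entry of each conjugate pair are read, so every [M]
    gives an element of [J]; the pair is recovered by [jH] and [jN] once [M] is hermitian. *)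
Definition mkJ (M : 'M[H]_3) (n : 'rV[H]_3) : J :=
  mkjordan (q0 (M i0 i0)) (q0 (M i1 i1)) (q0 (M i2 i2))
    (Cay (M i1 i2) (n 0 i0)) (Cay (M i2 i0) (n 0 i1)) (Cay (M i0 i1) (n 0 i2)).

Lemma mkJK (X : J) : mkJ (jH X) (jN X) = X.
Proof.
rewrite [RHS]mkjordanE /mkJ /jxi1 /jxi2 /jxi3 !mxE /=.
by rewrite /jx1 /jx2 /jx3; case: (X i0 i1) (X i1 i2) (X i2 i0) => ? ? [? ?] [? ?].
Qed.

Lemma jH_adj (X : J) : adjmx (jH X) = jH X.
Proof.
apply/matrixP => i j; rewrite !mxE.
by have := jordanE X i j; case: (X j i) (X i j) => ? ? [? ?] /= [].
Qed.

Lemma jN_mkJ M n : jN (mkJ M n) = n.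
Proof.
apply/matrixP => i j; rewrite (ord1 i) !mxE.
by move: j; apply: ord3P; rewrite /= /jx1 /jx2 /jx3 !mxE.
Qed.

Lemma jH_mkJ M n : adjmx M = M -> jH (mkJ M n) = M.
Proof.
move=> /matrixP h; have h' i j : qconj (M j i) = M i j by rewrite -[RHS]h !mxE.
have r i : Quat (q0 (M i i)) 0 0 0 = M i i.
  have := h' i i; case: (M i i) => [a b c d] [] /=.
  have z (t : R) : - t = t -> t = 0 by move=> ?; lra.
  by do 3! move=> /z ->.
apply/matrixP; apply: ord3P; apply: ord3P; rewrite !mxE /= ?r ?h' //.
Qed.

Lemma jordan_ext (X Y : J) : jH X = jH Y -> jN X = jN Y -> X = Y.
Proof. by move=> e1 e2; rewrite -(mkJK X) e1 e2 mkJK. Qed.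

Definition realq (r : R) : H := Quat r 0 0 0.

Lemma realqC r (q : H) : realq r * q = q * realq r.
Proof. by case: q => ? ? ? ?; congr Quat; rewrite /=; ring. Qed.

Definition rtr (M : 'M[H]_3) : R := q0 (\tr M).
Definition rdot (a b : 'rV[H]_3) : R := q0 ((a *m adjmx b) 0 0).

(** This formula and [jN_jmul] express the Jordan product through matrix products, the real trace
    and the real inner product of rows. All of these are compatible with [Sp(1)] and [Sp(3)], which
    is why [act] is multiplicative. Both sides are doubled to clear the factor 1/2. *)
Lemma jH_jmul (X Y : J) :
  jH (jmul X Y) *+ 2 = jH X *m jH Y + jH Y *m jH X
    - (adjmx (jN X) *m jN Y + adjmx (jN Y) *m jN X)
    + (realq (rdot (jN X) (jN Y)) *+ 2)%:M.
Proof.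
rewrite /rdot (mkjordanE X) (mkjordanE Y) jmulE /cdot.
move: (jxi1 X) (jxi2 X) (jxi3 X) (jx1 X) (jx2 X) (jx3 X) => a1 a2 a3.
move: (jxi1 Y) (jxi2 Y) (jxi3 Y) (jx1 Y) (jx2 Y) (jx3 Y) => b1 b2 b3.
move=> [[? ? ? ?] [? ? ? ?]] [[? ? ? ?] [? ? ? ?]] [[? ? ? ?] [? ? ? ?]].
move=> [[? ? ? ?] [? ? ? ?]] [[? ? ? ?] [? ? ? ?]] [[? ? ? ?] [? ? ? ?]].
apply/matrixP; apply: ord3P; apply: ord3P;
  rewrite /jN /jx1 /jx2 /jx3 !(mxE, big_ord_recl, big_ord0) /= ?mxE /=;
  congr Quat; rewrite /=; by field.
Qed.

Lemma jN_jmul (X Y : J) :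
  jN (jmul X Y) *+ 2 = realq (rtr (jH X)) *: jN Y + realq (rtr (jH Y)) *: jN X
    - (jN X *m jH Y + jN Y *m jH X).
Proof.
rewrite /rtr /mxtrace (mkjordanE X) (mkjordanE Y) jmulE /cdot.
move: (jxi1 X) (jxi2 X) (jxi3 X) (jx1 X) (jx2 X) (jx3 X) => a1 a2 a3.
move: (jxi1 Y) (jxi2 Y) (jxi3 Y) (jx1 Y) (jx2 Y) (jx3 Y) => b1 b2 b3.
move=> [[? ? ? ?] [? ? ? ?]] [[? ? ? ?] [? ? ? ?]] [[? ? ? ?] [? ? ? ?]].
move=> [[? ? ? ?] [? ? ? ?]] [[? ? ? ?] [? ? ? ?]] [[? ? ? ?] [? ? ? ?]].
apply/matrixP => i; rewrite (ord1 i) {i}; apply: ord3P;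
  rewrite /jN /jx1 /jx2 /jx3 !(mxE, big_ord_recl, big_ord0) /= ?mxE /=;
  congr Quat; rewrite /=; by field.
Qed.

End MatrixModel.

(** * The action of Sp(1) x Sp(3) *)

Section SymplecticAction.
Variable R : realType.
Local Notation H := (quat R).
Local Notation C := (cayley R).
Local Notation J := (jordan R).

Lemma qconj_mul1 (p : H) : qnorm p = 1 -> qconj p * p = 1.
Proof. by move=> h; rewrite -{2}(qconjK p); apply/qnorm1P; rewrite qnormJ. Qed.

Lemma adjmx1 n : adjmx 1%:M = 1%:M :> 'M[H]_n.
Proof. by have := (unitary1 R n).2; rewrite mulmx1. Qed.

Lemma q0_mulC (p q : H) : q0 (p * q) = q0 (q * p).
Proof. by case: p q => ? ? ? ? [? ? ? ?] /=; ring. Qed.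

Lemma q0_sum (I : Type) (r : seq I) (F : I -> H) :
  q0 (\sum_(i <- r) F i) = \sum_(i <- r) q0 (F i).
Proof. exact: (big_morph (@q0 R) (fun _ _ => erefl) erefl). Qed.

(** The trace over [H] is not cyclic, but its real part is, because [q0 (p * q) = q0 (q * p)]. *)
Lemma q0_trC m n (M : 'M[H]_(m, n)) N : q0 (\tr (M *m N)) = q0 (\tr (N *m M)).
Proof.
rewrite /mxtrace !q0_sum; under eq_bigr do rewrite mxE q0_sum.
rewrite exchange_big; apply: eq_bigr => i _; rewrite mxE q0_sum.
by apply: eq_bigr => j _; rewrite q0_mulC.
Qed.

(** Membership in [Sp(n)]. Both one-sided identities are recorded, since over the noncommutative [H]
    a determinant argument does not deduce one from the other. *)
Definition symplectic n (A : 'M[H]_n) : Prop :=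
  adjmx A *m A = 1%:M /\ A *m adjmx A = 1%:M.

Definition act (p : H) (A : 'M[H]_3) (X : J) : J :=
  mkJ (A *m jH X *m adjmx A) (p *: (jN X *m adjmx A)).

Lemma jH_act p A X : jH (act p A X) = A *m jH X *m adjmx A.
Proof. by rewrite jH_mkJ // !adjmxM adjmxK jH_adj mulmxA. Qed.

Lemma jN_act p A X : jN (act p A X) = p *: (jN X *m adjmx A).
Proof. by rewrite jN_mkJ. Qed.

Lemma act1 X : act 1 1%:M X = X.
Proof.
apply: jordan_ext; first by rewrite jH_act adjmx1 mulmx1 mul1mx.
by rewrite jN_act adjmx1 mulmx1 scale1r.
Qed.

Lemma actM p q A B X : act p A (act q B X) = act (p * q) (A *m B) X.
Proof.
apply: jordan_ext; first by rewrite (jH_act p A) (jH_act q B) (jH_act (p * q)) adjmxM !mulmxA.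
rewrite (jN_act p A) (jN_act q B) (jN_act (p * q)) adjmxM mulmxA.
by rewrite -scalemxAl scalerA.
Qed.

Lemma jH_linear a (X Y : J) : jH (a *: X + Y) = (realq a)%:M *m jH X + jH Y.
Proof.
apply/matrixP => i j; rewrite mul_scalar_mx !mxE /=.
by case: (X i j) => [[? ? ? ?] ?]; congr (_ + _); congr Quat; rewrite /=; ring.
Qed.

Lemma jN_linear a (X Y : J) : jN (a *: X + Y) = realq a *: jN X + jN Y.
Proof.
apply/matrixP => i; rewrite (ord1 i) {i}; apply: ord3P; rewrite !mxE /= /jx1 /jx2 /jx3 !mxE /=.
- by case: (X _ _) => [? [? ? ? ?]]; congr (_ + _); congr Quat; rewrite /=; ring.
- by case: (X _ _) => [? [? ? ? ?]]; congr (_ + _); congr Quat; rewrite /=; ring.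
- by case: (X _ _) => [? [? ? ? ?]]; congr (_ + _); congr Quat; rewrite /=; ring.
Qed.

Lemma realq_mxC m n r (A : 'M[H]_(m, n)) : A *m (realq r)%:M = realq r *: A.
Proof.
apply/matrixP => i j; rewrite !mxE (bigD1 j) //= !mxE eqxx mulr1n big1 ?addr0 ?realqC //.
by move=> k kj; rewrite !mxE (negbTE kj) mulr0n mulr0.
Qed.

Lemma act_linear p A : linear (act p A : J -> J).
Proof.
move=> a X Y; apply: jordan_ext.
  rewrite jH_linear (jH_act p A X) (jH_act p A Y) (jH_act p A (a *: X + Y)).
  rewrite jH_linear mulmxDr mulmxDl mulmxA realq_mxC.
  by rewrite !mul_scalar_mx !scalemxAl.
rewrite jN_linear (jN_act p A X) (jN_act p A Y) (jN_act p A (a *: X + Y)).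
rewrite jN_linear mulmxDl scalerDr -scalemxAl.
by rewrite !scalerA realqC.
Qed.

Lemma jHD (X Y : J) : jH (X + Y) = jH X + jH Y.
Proof. by apply/matrixP => i j; rewrite !mxE. Qed.

Lemma jND (X Y : J) : jN (X + Y) = jN X + jN Y.
Proof. by have := jN_linear 1 X Y; rewrite scale1r => ->; rewrite [realq 1 *: _]scale1r. Qed.

(** Removes the factor 2 of [jH_jmul] and [jN_jmul]. *)
Lemma jordan_double_inj (X Y : J) : X + X = Y + Y -> X = Y.
Proof.
have d (q r : H) : q + q = r + r -> q = r.
  by case: q r => [? ? ? ?] [? ? ? ?] [? ? ? ?]; congr Quat; lra.
move=> e; apply: jordan_ext; apply/matrixP => i j; apply: d.
  by move/(congr1 (fun Z => jH Z i j)): e; rewrite !jHD [LHS]mxE [RHS]mxE.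
by move/(congr1 (fun Z => jN Z i j)): e; rewrite !jND [LHS]mxE [RHS]mxE.
Qed.

Section Automorphism.
Variables (p : H) (A : 'M[H]_3).
Hypotheses (np : qnorm p = 1) (sA : symplectic A).

Lemma rtr_act X : rtr (jH (act p A X)) = rtr (jH X).
Proof. by rewrite jH_act /rtr -mulmxA q0_trC -mulmxA sA.1 mulmx1. Qed.

Lemma adjmx_scale (q : H) (a : 'rV[H]_3) : adjmx (q *: a) = adjmx a *m (qconj q)%:M.
Proof.
apply/matrixP => i j; rewrite !mxE big_ord_recl big_ord0 !mxE addr0 (ord1 j).
by rewrite mulr1n qconjM.
Qed.

Lemma rdot_act X Y : rdot (jN (act p A X)) (jN (act p A Y)) = rdot (jN X) (jN Y).
Proof.
rewrite (jN_act p A X) (jN_act p A Y) /rdot adjmx_scale adjmxM adjmxK -scalemxAl.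
rewrite -!mulmxA (mulmxA (adjmx A)) sA.1 mul1mx mulmxA !mxE.
rewrite q0_mulC big_ord_recl big_ord0 addr0 -mulrA [X in _ * (X * _)]mxE.
by rewrite mulr1n qconj_mul1 // mulr1 mxE.
Qed.

Lemma act_jmul X Y : act p A (jmul X Y) = jmul (act p A X) (act p A Y).
Proof.
(* Generalising over the elements of J keeps unification from unfolding them. *)
move: (jH_act p A X) (jN_act p A X) (rtr_act X) => HX NX tX.
move: (jH_act p A Y) (jN_act p A Y) (rtr_act Y) => HY NY tY.
move: (jH_act p A (jmul X Y)) (jN_act p A (jmul X Y)) (rdot_act X Y).
move: (jH_jmul X Y) (jN_jmul X Y) (jH_jmul (act p A X) (act p A Y)).
move: (jN_jmul (act p A X) (act p A Y)); move: (jmul (act p A X) (act p A Y)).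
move: (act p A (jmul X Y)) (act p A X) (act p A Y) (jmul X Y) HX NX tX HY NY tY.
move=> W' X' Y' W HX NX tX HY NY tY Z NZ HW NW HZ HW' NW' dXY.
have E1 (M N : 'M[H]_3) :
    A *m M *m adjmx A *m (A *m N *m adjmx A) = A *m (M *m N) *m adjmx A.
  by rewrite -!mulmxA (mulmxA (adjmx A) A) sA.1 mul1mx.
(* The conjugate of [p] coming from the adjoint of one row meets the [p] of the other row and
   cancels, so the products of rows do not see [p]. *)
have E2 (a b : 'rV[H]_3) :
    A *m adjmx a *m (qconj p)%:M *m (p *: (b *m adjmx A)) =
    A *m (adjmx a *m b) *m adjmx A.
  by rewrite -mulmxA mul_scalar_mx scalerA (qconj_mul1 np) scale1r !mulmxA.
have E3 r : A *m (realq r)%:M *m adjmx A = (realq r)%:M.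
  by rewrite realq_mxC -scalemxAl sA.2 -mul_scalar_mx mulmx1.
have E4 (a : 'rV[H]_3) (N : 'M[H]_3) :
    p *: (a *m adjmx A) *m (A *m N *m adjmx A) = p *: (a *m N *m adjmx A).
  rewrite -scalemxAl; congr (_ *: _).
  by rewrite -!mulmxA (mulmxA (adjmx A) A) sA.1 mul1mx.
have E5 r (a : 'rV[H]_3) :
    realq r *: (p *: (a *m adjmx A)) = p *: (realq r *: a *m adjmx A).
  by rewrite -scalemxAl !scalerA realqC.
apply: jordan_double_inj.
have dM (M : 'M[H]_3) : A *m M *m adjmx A + A *m M *m adjmx A =
    A *m (M + M) *m adjmx A by rewrite mulmxDr mulmxDl.
apply: jordan_ext.
- rewrite !jHD HW' dM -!mulr2n HZ HW dXY NX NY HX HY !adjmx_scale !adjmxM adjmxK.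
  rewrite !E1 !E2 mulmxDr mulmxDl mulmxBr mulmxBl !mulmxDr !mulmxDl.
  by rewrite (_ : realq _ *+ 2 = realq (rdot (jN X) (jN Y) *+ 2)) ?E3 // mulr2n
    /realq; congr Quat; rewrite /= ?addr0.
- rewrite !jND NW' -scalerDr -mulmxDl -!mulr2n NZ NW tX tY NX NY HX HY !E4 !E5.
  by rewrite mulmxBl !mulmxDl scalerBr !scalerDr.
Qed.

Lemma act_F4 : F4_set (act p A).
Proof.
split; [exact: act_linear| |exact: act_jmul].
exists (act (qconj p) (adjmx A)) => X; rewrite actM.
  by rewrite (qconj_mul1 np) sA.1 act1.
by have /qnorm1P -> := np; rewrite sA.2 act1.
Qed.

End Automorphism.
End SymplecticAction.

(** * The centraliser of the matrix of sigma_3 *)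

Section Embedding.
Variable R : realType.
Local Notation H := (quat R).
Local Notation C := (cayley R).
Local Notation J := (jordan R).

Lemma sum3E (V : nmodType) (F : 'I_3 -> V) :
  \sum_i F i = F i0 + F i1 + F i2.
Proof.
rewrite !big_ord_recl big_ord0 addr0 addrA.
by congr (F _ + F _ + F _); exact: val_inj.
Qed.

Definition diag3 (a b c : H) : 'M[H]_3 :=
  \matrix_(i, j) (match val i with 0%N => a | 1%N => b | _ => c end *+ (i == j)).

Fact qconj0 : qconj 0 = 0 :> H.
Proof. by congr Quat; rewrite /= oppr0. Qed.

(** Diagonal matrices act on [x1], [x2], [x3] separately; this links the matrix model with [gamma3]
    and [sigma3], which are given componentwise. *)
Lemma act_diag3 (p a b c : H) X :
  qnorm a = 1 -> qnorm b = 1 -> qnorm c = 1 ->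
  act p (diag3 a b c) X =
  jordan_map
    (fun x => Cay (b * cay1 x * qconj c) (p * cay2 x * qconj a))
    (fun x => Cay (c * cay1 x * qconj a) (p * cay2 x * qconj b))
    (fun x => Cay (a * cay1 x * qconj b) (p * cay2 x * qconj c)) X.
Proof.
move=> /qnorm1P na /qnorm1P nb /qnorm1P nc.
(* The diagonal entries of a hermitian matrix are real, hence central, so conjugation by a unit
   quaternion leaves them alone. *)
have r (q : H) (t : R) : q * qconj q = 1 -> q0 (q * realq t * qconj q) = t.
  by move=> h; rewrite -realqC -mulrA h mulr1.
have e (i : 'I_3) : cay1 (X i i) = realq (q0 (cay1 (X i i))).
  have := congr1 (fun M : 'M[H]_3 => M i i) (jH_adj X); rewrite !mxE.
  case: (cay1 (X i i)) => [a0 a1 a2 a3] [] /=.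
  have z (t : R) : - t = t -> t = 0 by move=> ?; lra.
  by do 3! move=> /z ->.
have E := (mxE, sum3E, mulr0n, mulr1n, qconj0, mul0r, mulr0, addr0, add0r).
rewrite /act /mkJ /jordan_map /jxi1 /jxi2 /jxi3 /jx1 /jx2 /jx3.
have X0 : forall i (d : H), d * qconj d = 1 ->
    q0 (d * cay1 (X i i) * qconj d) = q0 (cay1 (X i i)).
  by move=> i d hd; rewrite e r.
congr mkjordan; do ?congr Cay; rewrite -?(X0 i0 a na) -?(X0 i1 b nb) -?(X0 i2 c nc);
  try congr (q0 _); rewrite ?E /= ?E /= ?E /= ?E //= ?mulrA //.
Qed.

Lemma omega_qnorm : qnorm (omega R) = 1.
Proof. by rewrite /qnorm omega_norm expr0n /= !addr0 sqrtr1. Qed.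

Lemma diag3_1 : diag3 1 1 1 = 1%:M.
Proof. by apply/matrixP; apply: ord3P => j; rewrite !mxE. Qed.

Lemma jordan_map_ext (f1 f2 f3 g1 g2 g3 : C -> C) (X : J) :
  f1 =1 g1 -> f2 =1 g2 -> f3 =1 g3 -> jordan_map f1 f2 f3 X = jordan_map g1 g2 g3 X.
Proof. by rewrite /jordan_map => -> -> ->. Qed.

Lemma qconj1 : qconj 1 = 1 :> H.
Proof. by congr Quat; rewrite /= oppr0. Qed.

Lemma gamma3E (X : J) : val (gamma3 R) X = act (omega R) 1%:M X.
Proof.
rewrite -diag3_1 act_diag3 ?qnorm1 //; apply: jordan_map_ext => x;
  by rewrite /gamma3_cayley qconj1 !(mulr1, mul1r).
Qed.

Definition sigma_mx : 'M[H]_3 := diag3 1 (qconj (omega R)) (omega R).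

(** Multiplying [m + n e4] by a quaternion [w] gives [w m + (n w) e4] on the left and
    [m w + (n w^bar) e4] on the right. On [x1] the two effects on the e4-part cancel, which matches
    the entry 1 of [sigma_mx]. *)
Lemma sigma3E (X : J) : val (sigma3 R) X = act 1 sigma_mx X.
Proof.
rewrite act_diag3 ?qnormJ ?qnorm1 ?omega_qnorm // qconj1 qconjK.
rewrite -[LHS]/(jordan_map (sigma3_cayley1 (omega R)) (sigma3_cayley2 (omega R))
  (sigma3_cayley3 (omega R)) X).
move: (omega_norm R); rewrite /omega; move: (- 2^-1) (Num.sqrt 3 / 2) => a b /= h.
have {}h : b ^+ 2 = 1 - a ^+ 2 by rewrite -h; ring.
by apply: jordan_map_ext => -[[? ? ? ?] [? ? ? ?]];
  rewrite /sigma3_cayley1 /sigma3_cayley2 /sigma3_cayley3 /cmul /cayley_of_quat /=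
    ?(mul1r, mulr1); congr Cay; congr Quat; rewrite /=; ring: h.
Qed.

Definition e2 : H := Quat 0 0 1 0.

(* The centraliser of diag(1, w^bar, w) in Sp(3): conjugation by
   diag(1, 1, e2) turns that matrix into diag(1, w^bar, w^bar). *)
Definition embed (q : H) (B : 'M[H]_2) : 'M[H]_3 :=
  \matrix_(i, j)
    match val i, val j with
    | 0%N, 0%N => q | 0%N, _ => 0 | _, 0%N => 0
    | 1%N, 1%N => B j0 j0 | 1%N, _ => - (B j0 j1 * e2)
    | _, 1%N => e2 * B j1 j0 | _, _ => - (e2 * B j1 j1 * e2)
    end.

Lemma ord2P (P : 'I_2 -> Prop) : P j0 -> P j1 -> forall i, P i.
Proof.
move=> h0 h1 [[|[|//]] hi]; first by rewrite (bool_irrelevance hi isT).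
by rewrite (bool_irrelevance hi isT).
Qed.

Lemma sum2E (V : nmodType) (F : 'I_2 -> V) : \sum_i F i = F j0 + F j1.
Proof.
rewrite !big_ord_recl big_ord0 addr0.
by congr (F _ + F _); exact: val_inj.
Qed.

(** The lower block of [embed] is [D B D^*] with [D = diag(1, e2)], and the inner factor [D^* D] is
    the identity because [e2 * e2 = -1]. *)
Lemma embedM q r B D : embed (q * r) (B *m D) = embed q B *m embed r D.
Proof.
apply/matrixP; apply: ord3P; apply: ord3P; rewrite !mxE !sum3E ?mxE /=
  ?sum2E ?(mulr0, mul0r, addr0, add0r) //.
all: move: (B j0 j0) (B j0 j1) (B j1 j0) (B j1 j1) (D j0 j0) (D j0 j1) (D j1 j0) (D j1 j1);
  do 8 move=> [? ? ? ?]; congr Quat => /=; ring.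
Qed.

Lemma embed_adj q B : adjmx (embed q B) = embed (qconj q) (adjmx B).
Proof.
apply/matrixP; apply: ord3P; apply: ord3P; rewrite !mxE /= ?mxE ?qconj0 //.
all: move: (B j0 j0) (B j0 j1) (B j1 j0) (B j1 j1);
  do 4 move=> [? ? ? ?]; congr Quat => /=; ring.
Qed.

Lemma embed1 : embed 1 1%:M = 1%:M.
Proof.
apply/matrixP; apply: ord3P; apply: ord3P; rewrite !mxE //=; congr Quat => /=; ring.
Qed.

Lemma embed_symplectic q B : qnorm q = 1 -> unitary B -> symplectic (embed q B).
Proof.
move=> nq uB; split; rewrite embed_adj -embedM.
  by rewrite (qconj_mul1 nq) uB.2 embed1.
by have /qnorm1P -> := nq; rewrite unitary_adjmx // embed1.
Qed.

(** Complex entries matter here: after conjugation by [diag(1, e2)] the lower block of [sigma_mx] is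
    the scalar [w^bar], which commutes with complex matrices but not with all quaternionic ones. *)
Lemma embed_sigma q (B : 'M[H]_2) : (forall i j, complexes (B i j)) ->
  sigma_mx *m embed q B = embed q B *m sigma_mx.
Proof.
move=> hB; have h i j := (complexesP _).1 (hB i j).
rewrite /sigma_mx /omega; move: (- 2^-1) (Num.sqrt 3 / 2) => a b.
have [[h00 h00'] [h01 h01']] := (h j0 j0, h j0 j1).
have [[h10 h10'] [h11 h11']] := (h j1 j0, h j1 j1).
apply/matrixP; apply: ord3P; apply: ord3P; rewrite !mxE !sum3E ?mxE /=
  ?(mulr0n, mulr1n) ?(mulr0, mul0r, addr0, add0r, mul1r, mulr1) //.
all: congr Quat => /=; rewrite ?h00 ?h00' ?h01 ?h01' ?h10 ?h10' ?h11 ?h11'; ring.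
Qed.

End Embedding.

(** * The homomorphism phi and its kernel *)

Section Phi.
Variable R : realType.
Local Notation H := (quat R).
Local Notation C := (cayley R).
Local Notation J := (jordan R).

Definition F4_fixed2 := subgroupI (F4_fixed (gamma3 R)) (F4_fixed (sigma3 R)).

Lemma F4_ext (a b : F4 R) : val a =1 val b -> a = b.
Proof. by move=> h; apply: val_inj; apply/funext. Qed.

Lemma F4_mulE (a b : F4 R) X : val (a * b)%g X = val a (val b X).
Proof. by []. Qed.

Lemma F4_fixedE (g a : F4 R) :
  subgroup_set (F4_fixed g) a <-> forall X, val a (val g X) = val g (val a X).
Proof.
split=> [h X|h].
  rewrite -!F4_mulE; congr (val _ _); rewrite -[in RHS]h.
  by rewrite !mulgA mulgV mul1g.
rewrite /= /F4_fixed_set /= -mulgA; have -> : (a * g = g * a)%g by apply: F4_ext.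
by rewrite mulgA mulVg mul1g.
Qed.

Definition phi_act (x : U1_Sp1_U2 R) : F4 R :=
  F4_of (act_F4 (U1P x.1.1).2 (embed_symplectic (Sp1P x.1.2) (UP x.2))).

Lemma phi_actE x X :
  val (phi_act x) X = act (val x.1.1) (embed (val x.1.2) (val x.2)) X.
Proof. by []. Qed.

Lemma complexesC (p q : H) : complexes p -> complexes q -> p * q = q * p.
Proof.
case: p q => [a b c d] [a' b' c' d'] /complexesP[/= -> ->] /complexesP[/= -> ->].
by congr Quat => /=; ring.
Qed.

Lemma phi_fixed x : subgroup_set F4_fixed2 (phi_act x).
Proof.
split; apply/F4_fixedE => X; rewrite !phi_actE.
- rewrite !gamma3E !actM mulmx1 mul1mx complexesC //; first by case: (U1P x.1.1).
  exact/complexesP.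
- by rewrite !sigma3E !actM mulr1 mul1r embed_sigma //; case: (UP x.2).
Qed.

Definition phi (x : U1_Sp1_U2 R) : subgroup_type F4_fixed2 :=
  SigSub (mem_set (phi_fixed x)).

Lemma phiE x X : val (val (phi x)) X = act (val x.1.1) (embed (val x.1.2) (val x.2)) X.
Proof. by []. Qed.

Lemma fixed2_ext (a b : subgroup_type F4_fixed2) :
  (forall X, val (val a) X = val (val b) X) -> a = b.
Proof. by move=> h; apply: val_inj; apply: F4_ext. Qed.

Lemma phiM : {morph phi : x y / (x * y)%g}.
Proof.
move=> x y; apply: fixed2_ext => X.
by rewrite -[RHS]/(val (val (phi x)) (val (val (phi y)) X)) !phiE actM -embedM.
Qed.

(** Evaluation on the elements [(0, n)] gives [p n = n A] for every row [n]. Multiples of unit rows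
    then show that [A] is the scalar matrix [p] and that [p] is central in [H], so [p] is 1 or
    -1. *)
Lemma phi_eq1 x : phi x = 1%g -> subgroup_set (Z2 R) x.
Proof.
case: x => [[p q] B] e.
have {}e X : act (val p) (embed (val q) (val B)) X = X.
  by rewrite -(phiE (p, q, B)) e.
have sA := embed_symplectic (Sp1P q) (UP B).
have [A AE] : {A | A = embed (val q) (val B)} by eexists.
rewrite -AE in e sA.
have pA (n : 'rV[H]_3) : val p *: n = n *m A.
  have := congr1 (@jN R) (e (mkJ 0 n)); rewrite jN_act !jN_mkJ => {2}<-.
  by rewrite -scalemxAl -mulmxA sA.1 mulmx1.
have Aij (i j : 'I_3) (r : H) : val p * (r *+ (i == j)) = r * A i j.
  have := congr1 (fun M : 'rV[H]_3 => M 0 j) (pA (\row_k (r *+ (i == k)))).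
  rewrite !mxE => ->; rewrite (bigD1 i) //= mxE eqxx mulr1n big1 ?addr0 // => k ki.
  by rewrite mxE eq_sym (negbTE ki) mul0r.
have pr (r : H) : val p * r = r * val p.
  have := Aij i0 i0 1; have := Aij i0 i0 r; rewrite eqxx !mulr1n => ->.
  by rewrite mul1r mulr1 => <-.
have A1 (i j : 'I_3) : val p *+ (i == j) = A i j.
  by have := Aij i j 1; rewrite mul1r mulrnAr mulr1.
have [_ np] := U1P p.
(* Commuting with [e1] and [e2] kills the imaginary part of [p], and a real number of norm one is a
   sign. *)
have [p1|p1] : val p = 1 \/ val p = -1.
  have := pr (e2 R); have := pr (Quat 0 1 0 0); move: np; rewrite qnorm1P.
  case: (val p) => a b c d /= [] h _ _ _ [] _ _ h1 h2 [] _ h3 _ h4.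
  have hb : b = 0 by lra.
  have hc : c = 0 by lra.
  have hd : d = 0 by lra.
  move: h; rewrite hb hc hd => h; have : a ^+ 2 = 1 by rewrite -h; ring.
  move/eqP; rewrite sqrf_eq1 => /orP[] /eqP ->; [left|right] => //.
  by congr Quat; rewrite oppr0.
  left; have {}A1 i j : A i j = 1 *+ (i == j) by rewrite -A1 p1.
  have q1 : val q = 1 by have := A1 i0 i0; rewrite AE mxE.
  have B1 : val B = 1%:M.
    have := A1 i2 i2; have := A1 i2 i1; have := A1 i1 i2; have := A1 i1 i1.
    rewrite AE !mxE /= => h00 h01 h10 h11.
    apply/matrixP; apply: ord2P; apply: ord2P; rewrite !mxE //.
    + case: (val B j0 j1) h01 => ? ? ? ? [/= ? ? ? ?]; congr Quat => /=; lra.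
    + case: (val B j1 j0) h10 => ? ? ? ? [/= ? ? ? ?]; congr Quat => /=; lra.
    + case: (val B j1 j1) h11 => ? ? ? ? [/= ? ? ? ?]; congr Quat => /=; lra.
  by congr (_, _, _); apply: val_inj.
right; have {}A1 i j : A i j = -1 *+ (i == j) by rewrite -A1 p1.
have q1 : val q = -1 by have := A1 i0 i0; rewrite AE mxE.
have B1 : val B = - 1%:M.
  have := A1 i2 i2; have := A1 i2 i1; have := A1 i1 i2; have := A1 i1 i1.
  rewrite AE !mxE /= => h00 h01 h10 h11.
  apply/matrixP; apply: ord2P; apply: ord2P; rewrite !mxE ?mulr0n ?oppr0 //.
  + case: (val B j0 j1) h01 => ? ? ? ? [/= ? ? ? ?]; congr Quat => /=; lra.
  + case: (val B j1 j0) h10 => ? ? ? ? [/= ? ? ? ?]; congr Quat => /=; lra.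
  + case: (val B j1 j1) h11 => ? ? ? ? [/= ? ? ? ?]; congr Quat => /=; lra.
by congr (_, _, _); apply: val_inj.
Qed.

Lemma phi_Z2 x : subgroup_set (Z2 R) x -> phi x = 1%g.
Proof.
case=> ->; first by apply: (mulgI (phi 1%g)); rewrite -phiM !mulg1.
apply: fixed2_ext => X; rewrite phiE /=.
have -> : embed (-1) (- 1%:M) = - 1%:M :> 'M[H]_3.
  apply/matrixP; apply: ord3P; apply: ord3P; rewrite !mxE ?mulr0n ?oppr0 //=;
    by congr Quat; rewrite /=; ring.
have aN1 : adjmx (- 1%:M) = - 1%:M :> 'M[H]_3.
  by rewrite -{2}(adjmx1 R 3); apply/matrixP => i j; rewrite !mxE; case: (_ == _).
apply: jordan_ext.
  by rewrite jH_act aN1 mulNmx mulmxN mulmx1 opprK mul1mx.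
by rewrite jN_act aN1 mulmxN mulmx1; apply/matrixP => i j; rewrite !mxE mulN1r opprK.
Qed.

End Phi.

(** * Peirce decomposition *)

Section Peirce.
Variable R : realType.
Local Notation H := (quat R).
Local Notation C := (cayley R).
Local Notation J := (jordan R).

Lemma mkjordan_inj a b c (x y z : C) a' b' c' x' y' z' :
  mkjordan a b c x y z = mkjordan a' b' c' x' y' z' ->
  [/\ a = a', b = b', c = c' & [/\ x = x', y = y' & z = z']].
Proof.
move=> e; split; last split.
- by have := congr1 (@jxi1 R) e; rewrite /jxi1 !mxE.
- by have := congr1 (@jxi2 R) e; rewrite /jxi2 !mxE.
- by have := congr1 (@jxi3 R) e; rewrite /jxi3 !mxE.
- by have := congr1 (@jx1 R) e; rewrite /jx1 !mxE.
- by have := congr1 (@jx2 R) e; rewrite /jx2 !mxE.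
- by have := congr1 (@jx3 R) e; rewrite /jx3 !mxE.
Qed.

Fact cayley_of_realD (a b : R) : cayley_of_real (a + b) = cayley_of_real a + cayley_of_real b.
Proof. by congr Cay; congr Quat; rewrite /= addr0. Qed.

Fact cayley_of_realZ (k a : R) : cayley_of_real (k * a) = k *: cayley_of_real a.
Proof. by congr Cay; congr Quat; rewrite /= mulr0. Qed.

Lemma mkjordanD a b c (x y z : C) a' b' c' x' y' z' :
  mkjordan a b c x y z + mkjordan a' b' c' x' y' z' =
  mkjordan (a + a') (b + b') (c + c') (x + x') (y + y') (z + z').
Proof.
by apply: jordan_inj; apply: ord3P; apply: ord3P; rewrite !mxE /= ?cayley_of_realD ?cconjD.
Qed.

Lemma mkjordanZ k a b c (x y z : C) :
  k *: mkjordan a b c x y z =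
  mkjordan (k * a) (k * b) (k * c) (k *: x) (k *: y) (k *: z).
Proof.
by apply: jordan_inj; apply: ord3P; apply: ord3P; rewrite !mxE /= ?cayley_of_realZ ?cconjZ.
Qed.

Lemma mkjordan0 : mkjordan 0 0 0 0 0 0 = 0 :> J.
Proof. by apply: jordan_inj; apply: ord3P; apply: ord3P; rewrite !mxE /= ?cconj0. Qed.

Fact cmulr0 (x : C) : cmul x 0 = 0.
Proof. by case: x => [[? ? ? ?] [? ? ? ?]]; congr Cay; congr Quat; rewrite /=; ring. Qed.

Fact cmul0r (x : C) : cmul 0 x = 0.
Proof. by case: x => [[? ? ? ?] [? ? ? ?]]; congr Cay; congr Quat; rewrite /=; ring. Qed.

Fact cdotr0 (x : C) : cdot x 0 = 0.
Proof. by rewrite /cdot cconj0 cmulr0. Qed.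

Fact cdot0r (x : C) : cdot 0 x = 0.
Proof. by rewrite /cdot cmul0r. Qed.

Definition jE1 : J := mkjordan 1 0 0 0 0 0.
Definition jE2 : J := mkjordan 0 1 0 0 0 0.
Definition jE3 : J := mkjordan 0 0 1 0 0 0.
Definition jF1 (x : C) : J := mkjordan 0 0 0 x 0 0.
Definition jF2 (x : C) : J := mkjordan 0 0 0 0 x 0.
Definition jF3 (x : C) : J := mkjordan 0 0 0 0 0 x.
Definition jone : J := mkjordan 1 1 1 0 0 0.

Definition mul_simp := (cmulr0, cmul0r, cdotr0, cdot0r, cconj0, scaler0, scale0r, 
  mulr0, mul0r, addr0, add0r, mulr1, mul1r, scale1r).

Lemma jmul_E1 a b c (x y z : C) :
  jmul jE1 (mkjordan a b c x y z) = mkjordan a 0 0 0 (2^-1 *: y) (2^-1 *: z).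
Proof. by rewrite /jE1 jmulE !mul_simp. Qed.

Lemma jmul_E2 a b c (x y z : C) :
  jmul jE2 (mkjordan a b c x y z) = mkjordan 0 b 0 (2^-1 *: x) 0 (2^-1 *: z).
Proof. by rewrite /jE2 jmulE !mul_simp. Qed.

Lemma jmul_E3 a b c (x y z : C) :
  jmul jE3 (mkjordan a b c x y z) = mkjordan 0 0 c (2^-1 *: x) (2^-1 *: y) 0.
Proof. by rewrite /jE3 jmulE !mul_simp. Qed.

Lemma jmul_F2F3 x y : jmul (jF2 x) (jF3 y) = jF1 (2^-1 *: cconj (cmul x y)).
Proof. by rewrite /jF2 /jF3 jmulE !mul_simp. Qed.

Lemma jmul_F3F1 x y : jmul (jF3 x) (jF1 y) = jF2 (2^-1 *: cconj (cmul x y)).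
Proof. by rewrite /jF1 /jF3 jmulE !mul_simp. Qed.

Lemma jmul_F1F2 x y : jmul (jF1 x) (jF2 y) = jF3 (2^-1 *: cconj (cmul x y)).
Proof. by rewrite /jF1 /jF2 jmulE !mul_simp. Qed.

Lemma jmul_F1F1 x y : jmul (jF1 x) (jF1 y) = mkjordan 0 (cdot x y) (cdot x y) 0 0 0.
Proof. by rewrite /jF1 jmulE !mul_simp. Qed.

Lemma jmul_F2F2 x y : jmul (jF2 x) (jF2 y) = mkjordan (cdot x y) 0 (cdot x y) 0 0 0.
Proof. by rewrite /jF2 jmulE !mul_simp. Qed.

Lemma jmulC (X Y : J) : jmul X Y = jmul Y X.
Proof. by apply: val_inj => /=; rewrite addrC. Qed.

Lemma jmul1 (X : J) : jmul jone X = X.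
Proof.
rewrite [X]mkjordanE /jone jmulE !mul_simp.
have h (x : C) : 2^-1 *: ((1 + 1) *: x) = x.
  by rewrite scalerA mulVf ?scale1r // (_ : 1 + 1 = 2%:R) // pnatr_eq0.
by rewrite !h.
Qed.

Lemma omega_sum : omega R * omega R + omega R + 1 = 0.
Proof.
have := omega_norm R; rewrite /omega /=; move: (Num.sqrt 3 / 2) => b h.
have {}h : b ^+ 2 = 3 / 4 by move: h; rewrite sqrrN; lra.
by congr Quat; rewrite /=; lra.
Qed.

(** Applying [w^2 + w + 1 = 0] to a vector fixed by [w] yields [3 n = 0]. *)
Lemma mul_omega_fix (n : H) : omega R * n = n -> n = 0.
Proof.
move=> h; have : (omega R * omega R + omega R + 1) * n = 0 by rewrite omega_sum mul0r.
rewrite !mulrDl -mulrA mul1r !h; case: n {h} => ? ? ? ? [? ? ? ?].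
by congr Quat; lra.
Qed.

Lemma omega_mul_fix (n : H) : n * omega R = n -> n = 0.
Proof.
move=> h; have : n * (omega R * omega R + omega R + 1) = 0 by rewrite omega_sum mulr0.
rewrite !mulrDr mulrA mulr1 !h; case: n {h} => ? ? ? ? [? ? ? ?].
by congr Quat; lra.
Qed.

Lemma gamma3_fix (x : C) : gamma3_cayley (omega R) x = x -> cay2 x = 0.
Proof. by case: x => m n [] /mul_omega_fix. Qed.

(** The sum over an orbit of the order-three map is three times the projection onto [H]. It turns
    commutation with [gamma3] into information on quaternion parts in [core_e4]. *)
Lemma gamma3_sum (x : C) :
  gamma3_cayley (omega R) (gamma3_cayley (omega R) x) + gamma3_cayley (omega R) x + x =
  Cay (cay1 x *+ 3) 0.
Proof.
case: x => m n; congr Cay => /=; first by rewrite !mulrS addr0 addrA.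
by rewrite mulrA -mulrDl -[X in _ + X]mul1r -mulrDl omega_sum mul0r.
Qed.

End Peirce.

(** * The common fixed space of [gamma3] and [sigma3] *)

Section FixedPoints.
Variable R : realType.
Local Notation H := (quat R).
Local Notation C := (cayley R).
Local Notation J := (jordan R).
Local Notation sphere := (fun s t : R => Cay (Quat 0 0 s t) 0).

Lemma omega_conj_sqr : qconj (omega R) * qconj (omega R) = omega R.
Proof.
have := omega_norm R; rewrite /omega /=; move: (Num.sqrt 3 / 2) => b hb.
have {}hb : b ^+ 2 = 3 / 4 by move: hb; rewrite sqrrN; lra.
by congr Quat; rewrite /=; lra.
Qed.

(** Write [m = z + z' e2] with complex [z] and [z']. The map fixes [z' e2], and multiplies [z] by
    the square of [w^bar], which is [w]; so a fixed [m] has [z = 0]. *)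
Lemma sigma3_fix1 (m : H) :
  qconj (omega R) * m * qconj (omega R) = m -> q0 m = 0 /\ q1 m = 0.
Proof.
move=> h; pose m' : H := Quat (q0 m) (q1 m) 0 0.
have h' : qconj (omega R) * m' * qconj (omega R) = m'.
  move: h; rewrite /m'; case: m {m'} => a b c d [/= h0 h1 _ _].
  by congr Quat; rewrite /=; [rewrite -[RHS]h0|rewrite -[RHS]h1| |]; ring.
have /mul_omega_fix : omega R * m' = m'.
  rewrite -{1}omega_conj_sqr -mulrA (complexesC (q := m')) ?mulrA //; apply/complexesP => //=.
  by rewrite oppr0.
by rewrite /m' => -[-> ->].
Qed.

Definition both_fixed (X : J) := val (gamma3 R) X = X /\ val (sigma3 R) X = X.

Lemma jordan_map_mk f1 f2 f3 a b c (x y z : C) :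
  jordan_map f1 f2 f3 (mkjordan a b c x y z) = mkjordan a b c (f1 x) (f2 y) (f3 z).
Proof. by rewrite /jordan_map /jxi1 /jxi2 /jxi3 /jx1 /jx2 /jx3 !mxE. Qed.

Lemma gamma3_mk a b c (x y z : C) :
  val (gamma3 R) (mkjordan a b c x y z) =
  mkjordan a b c (gamma3_cayley (omega R) x) (gamma3_cayley (omega R) y)
    (gamma3_cayley (omega R) z).
Proof. exact: jordan_map_mk. Qed.

Lemma sigma3_mk a b c (x y z : C) :
  val (sigma3 R) (mkjordan a b c x y z) =
  mkjordan a b c (sigma3_cayley1 (omega R) x) (sigma3_cayley2 (omega R) y)
    (sigma3_cayley3 (omega R) z).
Proof. exact: jordan_map_mk. Qed.

(** Invariance under [gamma3] removes the e4-parts. On the remaining quaternions [sigma3] is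
    [w^bar m w^bar], [w m] and [m w], and only the first has nonzero fixed points, namely the span
    of [e2] and [e3]. The result is [R + Herm(2, C)]. *)
Lemma both_fixedP (X : J) : both_fixed X <->
  exists a b c s t, X = mkjordan a b c (sphere s t) 0 0.
Proof.
split=> [|[a [b [c [s [t ->]]]]]].
  rewrite /both_fixed (mkjordanE X); move: (jxi1 X) (jxi2 X) (jxi3 X) => a b c.
  move: (jx1 X) (jx2 X) (jx3 X) => [m1 n1] [m2 n2] [m3 n3].
  rewrite gamma3_mk sigma3_mk => -[/mkjordan_inj [_ _ _ []]].
  move=> /gamma3_fix /= -> /gamma3_fix /= -> /gamma3_fix /= ->.
  move=> /mkjordan_inj [_ _ _ []].
  rewrite /sigma3_cayley1 /sigma3_cayley2 /sigma3_cayley3 /cmul /=.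
  rewrite !(qconj0, mul0r, subr0, addr0).
  move=> [/sigma3_fix1 [e0 e1]] [/mul_omega_fix ->] [/omega_mul_fix ->].
  exists a, b, c, (q2 m1), (q3 m1).
  by case: m1 e0 e1 => ? ? ? ? /= -> ->.
have gz : gamma3_cayley (omega R) 0 = 0 by rewrite /gamma3_cayley /= mulr0.
split; first by rewrite gamma3_mk gz /gamma3_cayley /= mulr0.
rewrite sigma3_mk; congr mkjordan.
- rewrite /sigma3_cayley1 /omega; move: (omega_norm R); rewrite /omega /=.
  move: (- 2^-1) (Num.sqrt 3 / 2) => x y h.
  have {}h : y ^+ 2 = 1 - x ^+ 2 by rewrite -h; ring.
  by congr Cay; congr Quat; rewrite /=; ring: h.
- by rewrite /sigma3_cayley2 cmulr0.
- by rewrite /sigma3_cayley3 cmul0r.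
Qed.

Section Automorphism.
Variables (al : F4 R) (hal : subgroup_set (F4_fixed2 R) al).
Local Notation f := (val al).

Lemma F4D : {morph f : X Y / X + Y}.
Proof. by move=> X Y; have [l _ _] := F4P al; have := l 1 X Y; rewrite !scale1r. Qed.

Lemma F40 : f 0 = 0.
Proof. by apply: (addrI (f 0)); rewrite -F4D !addr0. Qed.

Lemma F4Z k : {morph f : X / k *: X}.
Proof.
by move=> X; have [l _ _] := F4P al; rewrite -[k *: X]addr0 l F40 addr0.
Qed.

Lemma F4_jmul X Y : f (jmul X Y) = jmul (f X) (f Y).
Proof. by have [_ _] := F4P al. Qed.

Lemma F4_inj : injective f.
Proof. by have [_ /bij_inj] := F4P al. Qed.

Lemma F4_gamma X : f (val (gamma3 R) X) = val (gamma3 R) (f X).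
Proof. by have [/F4_fixedE] := hal. Qed.

Lemma F4_sigma X : f (val (sigma3 R) X) = val (sigma3 R) (f X).
Proof. by have [_ /F4_fixedE] := hal. Qed.

Lemma F4_both_fixed X : both_fixed X -> both_fixed (f X).
Proof. by move=> [h1 h2]; split; rewrite -?F4_gamma -?F4_sigma ?h1 ?h2. Qed.

End Automorphism.

(** The image of the unit is a unit for the image of [al], which is all of [J]. *)
Lemma F4_jone (al : F4 R) : val al (jone R) = jone R.
Proof.
have [_ [g gK fK] _] := F4P al.
by rewrite -[LHS]jmul1 jmulC -{2}(fK (jone R)) -F4_jmul jmul1 fK.
Qed.

End FixedPoints.

(** * Images of the idempotents E1 and E2 *)

Section Idempotents.
Variable R : realType.
Local Notation H := (quat R).
Local Notation C := (cayley R).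
Local Notation J := (jordan R).
Local Notation sphere := (fun s t : R => Cay (Quat 0 0 s t) 0).
Variables (al : F4 R) (hal : subgroup_set (F4_fixed2 R) al).
Local Notation f := (val al).

Lemma both_fixed_mk (a b c s t : R) : both_fixed (mkjordan a b c (sphere s t) 0 0).
Proof. by apply/both_fixedP; exists a, b, c, s, t. Qed.

Lemma cay00 : Cay 0 0 = 0 :> C. Proof. by []. Qed.

Lemma both_fixed_mk0 (a b c : R) : both_fixed (mkjordan a b c 0 0 0).
Proof. exact: (both_fixed_mk a b c 0 0). Qed.

(** With [F4_both_fixed], this says that [al] maps the common fixed algebra onto itself. *)
Lemma F4_both_fixed_inv X : both_fixed X -> exists2 Y, both_fixed Y & X = f Y.
Proof.
move=> [hg hs]; have [_ [g gK fK] _] := F4P al; exists (g X); last by rewrite fK.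
by split; apply: (F4_inj (al := al)); rewrite ?(F4_gamma hal) ?(F4_sigma hal) fK ?hg ?hs.
Qed.

(** E1 spans a one-dimensional ideal of the common fixed algebra, and [al] carries it to another
    such ideal. *)
Lemma F4_E1_scale Y : both_fixed Y ->
  exists k, jmul (f (jE1 R)) Y = k *: f (jE1 R).
Proof.
move=> /F4_both_fixed_inv [Z /both_fixedP [a [b [c [s [t ->]]]]] ->].
exists a; rewrite -F4_jmul -F4Z jmul_E1 /jE1 mkjordanZ !scaler0.
by rewrite !mulr0 mulr1.
Qed.

Lemma jmul_sphere (a b c s t b' c' s' t' : R) :
  jmul (mkjordan a b c (sphere s t) 0 0) (mkjordan 0 b' c' (sphere s' t') 0 0) =
  mkjordan 0 (b * b' + (s * s' + t * t')) (c * c' + (s * s' + t * t'))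
    (sphere (2^-1 * ((b + c) * s' + (b' + c') * s))
      (2^-1 * ((b + c) * t' + (b' + c') * t))) 0 0.
Proof.
rewrite jmulE !mul_simp; congr mkjordan.
- by rewrite /cdot /=; ring.
- by rewrite /cdot /=; ring.
- by congr Cay; congr Quat; rewrite /=; ring.
Qed.

Lemma sphere_inj (s t s' t' : R) : sphere s t = sphere s' t' -> s = s' /\ t = t'.
Proof. by case. Qed.

Lemma sphereZ (k s t : R) : k *: sphere s t = sphere (k * s) (k * t) :> C.
Proof. by congr Cay; congr Quat; rewrite /= mulr0. Qed.

Lemma jE1_neq0 : jE1 R <> 0.
Proof. by rewrite -mkjordan0 => /mkjordan_inj [/eqP]; rewrite oner_eq0. Qed.

(** In [R + Herm(2, C)] the summand [R] is the only one-dimensional ideal containing a nonzero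
    idempotent. The proof tests the ideal property of the image of E1 on E1, on E2 and on [e2] in
    the place of [x1]. *)
Lemma F4_E1 : f (jE1 R) = jE1 R.
Proof.
have : both_fixed (f (jE1 R)) by apply: F4_both_fixed => //; exact: both_fixed_mk0.
have id : jmul (f (jE1 R)) (f (jE1 R)) = f (jE1 R).
  by rewrite -F4_jmul [X in f X]jmul_E1 !scaler0.
have nz : f (jE1 R) <> 0.
  by rewrite -(F40 al) => /F4_inj; exact: jE1_neq0.
have sc := F4_E1_scale.
move=> /both_fixedP [a [b [c [s [t e]]]]]; rewrite e in id nz sc *.
have [k] := sc _ (both_fixed_mk0 1 0 0).
rewrite jmulC jmul_E1 !scaler0 mkjordanZ !scaler0 => /mkjordan_inj [e1 e2 e3 [e4 _ _]].
(* If [a] is nonzero, the product with E1 has factor [k = 1], so all other coordinates vanish and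
   idempotency gives [a = 1]. *)
have [a0|a0] := eqVneq a 0; last first.
  have k1 : k = 1 by apply: (mulIf a0); rewrite mul1r.
  rewrite k1 !mul1r scale1r in e2 e3 e4.
  move: id; rewrite -e2 -e3 -e4 jmulE !mul_simp => /mkjordan_inj [h _ _ _].
  congr mkjordan; apply: (mulfI a0); by rewrite h mulr1.
exfalso; apply: nz; rewrite {}a0 in id sc *; move: id.
rewrite jmul_sphere => /mkjordan_inj [_ i1 i2 [/sphere_inj [i3 i4] _ _]].
have [k2] := sc _ (both_fixed_mk 0 1 0 0 0).
rewrite jmul_sphere mkjordanZ sphereZ => /mkjordan_inj [_ f1 f2 [/sphere_inj [f3 f4] _ _]].
(* If an off-diagonal coordinate [u] were nonzero, E2 would act with factor 1/2; this forces
   [b = c = 0], and then idempotency makes [u] zero after all. *)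
have st (u : R) : 2^-1 * ((b + c) * u + (b + c) * u) = u ->
    2^-1 * ((b + c) * 0 + (1 + 0) * u) = k2 * u -> u = 0.
  move=> u1 u2; apply/eqP/negP => /negP u0.
  have k2E : k2 = 2^-1 by apply: (mulIf u0); rewrite -u2; ring.
  have b0 : b = 0 by move: f1; rewrite k2E; lra.
  have c0 : c = 0 by move: f2; rewrite k2E; lra.
  by move/eqP: u0; apply; rewrite -u1 b0 c0; ring.
have s0 := st _ i3 f3; have t0 := st _ i4 f4.
(* The off-diagonal coordinate of this product gives [b + c = 0], while idempotency makes [b] and
   [c] nonnegative. *)
have [k3] := sc _ (both_fixed_mk 0 0 0 1 0).
rewrite jmul_sphere mkjordanZ sphereZ => /mkjordan_inj [_ _ _ [/sphere_inj [g3 _] _ _]].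
rewrite s0 t0 in i1 i2 g3 *; have b0 : b = 0 by nra.
have c0 : c = 0 by nra.
by rewrite b0 c0 cay00 mkjordan0.
Qed.

(** The image of E2 is an idempotent orthogonal to E1, so it lies in [Herm(2, C)], and it is neither
    0 nor the unit E2 + E3 there. It is therefore a projection of rank one: trace 1 and determinant
    [b * (1 - b) - (s * s + t * t) = 0]. *)
Lemma F4_E2 : exists b s t, s * s + t * t = b * (1 - b) /\
  f (jE2 R) = mkjordan 0 b (1 - b) (sphere s t) 0 0.
Proof.
have : both_fixed (f (jE2 R)) by apply: F4_both_fixed => //; exact: both_fixed_mk0.
have id : jmul (f (jE2 R)) (f (jE2 R)) = f (jE2 R).
  by rewrite -F4_jmul [X in f X]jmul_E2 !scaler0.
have nz : f (jE2 R) <> 0.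
  rewrite -(F40 al) => /F4_inj; rewrite -mkjordan0 => /mkjordan_inj [_ /eqP].
  by rewrite oner_eq0.
have o : f (jE2 R) <> mkjordan 0 1 1 0 0 0.
  have <- : f (mkjordan 0 1 1 0 0 0) = mkjordan 0 1 1 0 0 0.
    apply: (addrI (jE1 R)); rewrite -{1}F4_E1 -F4D /jE1 !mkjordanD !(addr0, add0r).
    exact: F4_jone.
  by move=> /F4_inj /mkjordan_inj [_ _ /eqP]; rewrite eq_sym oner_eq0.
have e10 : jmul (f (jE1 R)) (f (jE2 R)) = 0.
  by rewrite -F4_jmul jmul_E1 !scaler0 mkjordan0 F40.
move=> /both_fixedP [a [b [c [s [t e]]]]]; rewrite e in id nz o e10 *.
move: e10; rewrite F4_E1 jmul_E1 !scaler0 -mkjordan0 => /mkjordan_inj [a0 _ _ _].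
rewrite {}a0 in id nz o *; move: id.
rewrite jmul_sphere => /mkjordan_inj [_ i1 i2 [/sphere_inj [i3 i4] _ _]].
(* A nonzero off-diagonal coordinate gives the trace directly from idempotency. Otherwise [b] and
   [c] are 0 or 1, and the two equal choices are the excluded idempotents. *)
have bc : b + c = 1.
  have [s0|s0] := eqVneq s 0; last by apply: (mulIf s0); lra.
  have [t0|t0] := eqVneq t 0; last by apply: (mulIf t0); lra.
  rewrite s0 t0 in i1 i2 nz o.
  have b01 : b = 0 \/ b = 1.
    have /eqP : b * (b - 1) = 0 by [lra].
    by rewrite mulf_eq0 subr_eq0 => /orP[] /eqP; [left|right].
  have c01 : c = 0 \/ c = 1.
    have /eqP : c * (c - 1) = 0 by [lra].
    by rewrite mulf_eq0 subr_eq0 => /orP[] /eqP; [left|right].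
  case: b01 => hb; case: c01 => hc; rewrite hb hc ?addr0 ?add0r // in nz o *.
  by case: nz; exact: mkjordan0.
exists b, s, t; split; first by lra.
by congr mkjordan; lra.
Qed.
End Idempotents.

(** * Surjectivity of phi *)

Section Peeling.
Variable R : realType.
Local Notation H := (quat R).
Local Notation C := (cayley R).
Local Notation J := (jordan R).
Local Notation sphere := (fun s t : R => Cay (Quat 0 0 s t) 0).

Definition in_phi (al : F4 R) := exists x, phi_act x = al.

Lemma phi_actM : {morph @phi_act R : x y / (x * y)%g}.
Proof. by move=> x y; have /(congr1 val) := phiM x y. Qed.

Lemma in_phi_mull x al : in_phi (phi_act x * al)%g -> in_phi al.
Proof.
move=> [y e]; exists (x^-1 * y)%g; apply: (mulgI (phi_act x)).
by rewrite -phi_actM mulgA mulgV mul1g.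
Qed.

Lemma in_phi_inv x al : in_phi ((phi_act x)^-1 * al)%g -> in_phi al.
Proof. by move=> [y e]; exists (x * y)%g; rewrite phi_actM e mulgA mulgV mul1g. Qed.

Definition mx2 (a b c d : H) : 'M[H]_2 :=
  \matrix_(i, j) match val i, val j with
    | 0%N, 0%N => a | 0%N, _ => b | _, 0%N => c | _, _ => d end.

Lemma mx2_unitary (a b c d : H) :
  complexes a -> complexes b -> complexes c -> complexes d ->
  qconj a * a + qconj c * c = 1 -> qconj b * b + qconj d * d = 1 ->
  qconj a * b + qconj c * d = 0 -> qconj b * a + qconj d * c = 0 ->
  unitary (mx2 a b c d).
Proof.
move=> ca cb cc cd h00 h11 h01 h10; split.
  by apply: ord2P; apply: ord2P; rewrite mxE.
by apply/matrixP; apply: ord2P; apply: ord2P; rewrite !mxE sum2E !mxE.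
Qed.

(** With [v = v0 + v1 e1], the 2 by 2 matrix has first column [(u, v)], so it carries E2 to the
    projection onto that vector, written in the coordinates twisted by [e2]. *)
Lemma act_E2 (u v0 v1 : R) :
  act 1 (embed 1 (mx2 (Quat u 0 0 0) (Quat (- v0) v1 0 0) (Quat v0 v1 0 0) (Quat u 0 0 0)))
    (jE2 R) =
  mkjordan 0 (u ^+ 2) (v0 ^+ 2 + v1 ^+ 2) (sphere (- (u * v0)) (u * v1)) 0 0.
Proof.
have N0 : jN (jE2 R) = 0.
  apply/matrixP => i; rewrite (ord1 i) {i}.
  by apply: ord3P; rewrite !mxE /= /jx1 /jx2 /jx3 !mxE.
rewrite /act N0 mul0mx scaler0 /mkJ.
have E := (mxE, sum3E, qconj0, mul0r, mulr0, addr0, add0r, oppr0).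
congr mkjordan; rewrite ?E /= ?E /= ?E /= ?E /= ?E //; try by [|ring].
congr Cay; congr Quat => /=; ring.
Qed.

(** [U(2)] is transitive on projections of rank one: choose a unit vector [(u, v)] spanning the
    range, with real [u], and complete it to a unitary matrix. *)
Lemma F4_fix_E2 al : subgroup_set (F4_fixed2 R) al ->
  exists x, val (phi_act x) (jE2 R) = val al (jE2 R).
Proof.
move=> /F4_E2 [b [s [t [h ->]]]].
have [b0 b1] : 0 <= b /\ b <= 1.
  have := sqr_ge0 s; have := sqr_ge0 t; rewrite !expr2 => ? ?.
  by split; nra.
have [u [v0 [v1 [hu hv hs ht]]]] : exists u v0 v1, [/\ u ^+ 2 = b,
    v0 ^+ 2 + v1 ^+ 2 = 1 - b, - (u * v0) = s & u * v1 = t].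
  (* For [b = 0] the relation forces [s = t = 0] and the vector [(0, 1)] serves; otherwise [u] is
     the square root of [b] and [v] is found by division. *)
  have [bz|bz] := eqVneq b 0.
    exists 0, 1, 0; rewrite bz mul0r in h *.
    by split; rewrite ?(expr0n, expr1n) /=; nra.
  have rb : Num.sqrt b ^+ 2 = b by rewrite sqr_sqrtr.
  have rz : Num.sqrt b != 0 by rewrite sqrtr_eq0 -ltNge lt0r bz.
  exists (Num.sqrt b), (- (s / Num.sqrt b)), (t / Num.sqrt b); split => //.
  - rewrite sqrrN !expr_div_n rb; apply: (mulIf bz).
    by rewrite -mulrDl mulfVK // mulrC -h !expr2.
  - by rewrite mulrN opprK mulrC mulfVK.
  - by rewrite mulrC mulfVK.
have uB : unitary (mx2 (Quat u 0 0 0) (Quat (- v0) v1 0 0) (Quat v0 v1 0 0) (Quat u 0 0 0)).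
  by apply: mx2_unitary; rewrite ?complexesP //; congr Quat; rewrite /=; nra.
exists (1%g, 1%g, U_of uB); rewrite phi_actE act_E2 hu hv hs ht; reflexivity.
Qed.

End Peeling.

(** * Automorphisms fixing the diagonal idempotents *)

Section Triality.
Variable R : realType.
Local Notation H := (quat R).
Local Notation C := (cayley R).
Local Notation J := (jordan R).

(** The automorphisms of this shape form the subgroup [Spin(8)], with [(f1, f2, f3)] a triality
    triple of isometries. *)
Definition diag_by (al : F4 R) (f1 f2 f3 : C -> C) := forall a b c x y z,
  val al (mkjordan a b c x y z) = mkjordan a b c (f1 x) (f2 y) (f3 z).

Lemma half_eq0 (V : lmodType R) (x : V) : 2^-1 *: x = 0 -> x = 0.
Proof. by move/eqP; rewrite scaler_eq0 invr_eq0 pnatr_eq0 => /eqP. Qed.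

(** E3 is fixed too, since the unit is. Each space of [x_i] is a joint eigenspace of the
    multiplications by E1, E2, E3, with eigenvalue 0 for [E_i] and 1/2 for the other two, so [al]
    preserves it. *)
Lemma F4_diag (al : F4 R) : val al (jE1 R) = jE1 R -> val al (jE2 R) = jE2 R ->
  exists f1 f2 f3, diag_by al f1 f2 f3.
Proof.
move=> e1 e2; have e3 : val al (jE3 R) = jE3 R.
  apply: (addrI (jE1 R + jE2 R)); rewrite -{1}e1 -{1}e2 -!F4D.
  rewrite /jE1 /jE2 /jE3 !mkjordanD !(addr0, add0r); exact: F4_jone.
have h (t : R) : t = 2^-1 * t -> t = 0 by move=> ?; lra.
have p1 x : exists y, val al (jF1 x) = jF1 y.
  have a1 : jmul (jE1 R) (val al (jF1 x)) = 0.
    by rewrite -e1 -F4_jmul jmul_E1 !scaler0 mkjordan0 F40.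
  have a2 : jmul (jE2 R) (val al (jF1 x)) = 2^-1 *: val al (jF1 x).
    by rewrite -{1}e2 -F4_jmul jmul_E2 !scaler0 -F4Z mkjordanZ !(mulr0, scaler0).
  have a3 : jmul (jE3 R) (val al (jF1 x)) = 2^-1 *: val al (jF1 x).
    by rewrite -{1}e3 -F4_jmul jmul_E3 !scaler0 -F4Z mkjordanZ !(mulr0, scaler0).
  move: a1 a2 a3; rewrite (mkjordanE (val al _)).
  move: (jxi1 _) (jxi2 _) (jxi3 _) (jx1 _) (jx2 _) (jx3 _) => a b c y2 y3 y.
  rewrite jmul_E1 jmul_E2 jmul_E3 -mkjordan0 !mkjordanZ.
  move=> /mkjordan_inj [-> _ _ [_ /half_eq0 -> /half_eq0 ->]].
  move=> /mkjordan_inj [_ _ /esym/eqP + _]; rewrite mulf_eq0 invr_eq0 pnatr_eq0 /= => /eqP ->.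
  move=> /mkjordan_inj [_ /esym/eqP + _ _]; rewrite mulf_eq0 invr_eq0 pnatr_eq0 /= => /eqP ->.
  by exists y2.
have p2 x : exists y, val al (jF2 x) = jF2 y.
  have a2 : jmul (jE2 R) (val al (jF2 x)) = 0.
    by rewrite -e2 -F4_jmul jmul_E2 !scaler0 mkjordan0 F40.
  have a1 : jmul (jE1 R) (val al (jF2 x)) = 2^-1 *: val al (jF2 x).
    by rewrite -{1}e1 -F4_jmul jmul_E1 !scaler0 -F4Z mkjordanZ !(mulr0, scaler0).
  have a3 : jmul (jE3 R) (val al (jF2 x)) = 2^-1 *: val al (jF2 x).
    by rewrite -{1}e3 -F4_jmul jmul_E3 !scaler0 -F4Z mkjordanZ !(mulr0, scaler0).
  move: a2 a1 a3; rewrite (mkjordanE (val al _)).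
  move: (jxi1 _) (jxi2 _) (jxi3 _) (jx1 _) (jx2 _) (jx3 _) => a b c y1 y y3.
  rewrite jmul_E1 jmul_E2 jmul_E3 -mkjordan0 !mkjordanZ.
  move=> /mkjordan_inj [_ -> _ [/half_eq0 -> _ /half_eq0 ->]].
  move=> /mkjordan_inj [/h -> _ /esym/eqP + _].
  rewrite mulf_eq0 invr_eq0 pnatr_eq0 /= => /eqP ->.
  by exists y.
have p3 x : exists y, val al (jF3 x) = jF3 y.
  have a3 : jmul (jE3 R) (val al (jF3 x)) = 0.
    by rewrite -e3 -F4_jmul jmul_E3 !scaler0 mkjordan0 F40.
  have a1 : jmul (jE1 R) (val al (jF3 x)) = 2^-1 *: val al (jF3 x).
    by rewrite -{1}e1 -F4_jmul jmul_E1 !scaler0 -F4Z mkjordanZ !(mulr0, scaler0).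
  have a2 : jmul (jE2 R) (val al (jF3 x)) = 2^-1 *: val al (jF3 x).
    by rewrite -{1}e2 -F4_jmul jmul_E2 !scaler0 -F4Z mkjordanZ !(mulr0, scaler0).
  move: a3 a1 a2; rewrite (mkjordanE (val al _)).
  move: (jxi1 _) (jxi2 _) (jxi3 _) (jx1 _) (jx2 _) (jx3 _) => a b c y1 y2 y.
  rewrite jmul_E1 jmul_E2 jmul_E3 -mkjordan0 !mkjordanZ.
  move=> /mkjordan_inj [_ _ -> [/half_eq0 -> /half_eq0 -> _]].
  move=> /mkjordan_inj [/h -> /esym/eqP + _ _].
  rewrite mulf_eq0 invr_eq0 pnatr_eq0 /= => /eqP ->.
  by exists y.
have [[f1 h1] [f2 h2]] := (choice p1, choice p2); have [f3 h3] := choice p3.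
exists f1, f2, f3 => a b c x y z.
have -> : mkjordan a b c x y z =
    a *: jE1 R + b *: jE2 R + c *: jE3 R + jF1 x + jF2 y + jF3 z.
  by rewrite /jE1 /jE2 /jE3 /jF1 /jF2 /jF3 !mkjordanZ !mkjordanD
    !(mulr0, mulr1, scaler0, addr0, add0r).
rewrite !F4D !F4Z e1 e2 e3 h1 h2 h3.
by rewrite /jE1 /jE2 /jE3 /jF1 /jF2 /jF3 !mkjordanZ !mkjordanD
    !(mulr0, mulr1, scaler0, addr0, add0r).
Qed.

Lemma diag_byM al be f1 f2 f3 g1 g2 g3 : diag_by al f1 f2 f3 ->
  diag_by be g1 g2 g3 -> diag_by (al * be)%g (f1 \o g1) (f2 \o g2) (f3 \o g3).
Proof. by move=> h k a b c x y z; rewrite F4_mulE k h. Qed.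

Lemma phi_diag (p a b c : H) : complexes p -> complexes b -> complexes c ->
  qnorm p = 1 -> qnorm a = 1 -> qnorm b = 1 -> qnorm c = 1 ->
  exists x, diag_by (phi_act x)
    (fun x => Cay (b * cay1 x * qconj c) (p * cay2 x * qconj a))
    (fun x => Cay (c * cay1 x * qconj a) (p * cay2 x * qconj b))
    (fun x => Cay (a * cay1 x * qconj b) (p * cay2 x * qconj c)).
Proof.
move=> cp cb cc np na nb nc.
(* The conjugate of [c] appears because [- (e2 * qconj c * e2) = c] for complex [c]. *)
have uB : unitary (mx2 b 0 0 (qconj c)).
  apply: mx2_unitary; rewrite ?(mulr0, addr0, add0r, qconj0, mul0r) //.
  - exact: complexes0.
  - exact: complexes0.
  - exact: complexesJ.
  - exact: qconj_mul1.
  - by apply: qconj_mul1; rewrite qnormJ.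
exists (U1_of (conj cp np), Sp1_of na, U_of uB) => s t r x y z.
rewrite phi_actE /= (_ : embed _ _ = diag3 a b c); first by rewrite act_diag3 // jordan_map_mk.
move/complexesP: cc => [c2 c3].
apply/matrixP; apply: ord3P; apply: ord3P; rewrite !mxE //= ?(mul0r, mulr0, oppr0) //.
by case: c c2 c3 {nc uB} => ? ? ? ? /= -> ->; congr Quat; rewrite /=; ring.
Qed.

Section Diagonal.
Variables (al : F4 R) (f1 f2 f3 : C -> C).
Hypotheses (hal : subgroup_set (F4_fixed2 R) al) (d : diag_by al f1 f2 f3).

Lemma diag0 : [/\ f1 0 = 0, f2 0 = 0 & f3 0 = 0].
Proof.
have := d 0 0 0 0 0 0; rewrite mkjordan0 F40 -{1}mkjordan0.
by move=> /mkjordan_inj [_ _ _ [<- <- <-]].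
Qed.

Lemma diagZ k x y z :
  [/\ f1 (k *: x) = k *: f1 x, f2 (k *: y) = k *: f2 y & f3 (k *: z) = k *: f3 z].
Proof.
have := F4Z al k (mkjordan 0 0 0 x y z); rewrite d !mkjordanZ d.
by move=> /mkjordan_inj [_ _ _ [-> -> ->]].
Qed.

Lemma diagD x y : f1 (x + y) = f1 x + f1 y.
Proof.
have := F4D al (jF1 x) (jF1 y); rewrite /jF1 !d mkjordanD d mkjordanD.
by move=> /mkjordan_inj [_ _ _ []].
Qed.

Lemma diag_F x : [/\ val al (jF1 x) = jF1 (f1 x), val al (jF2 x) = jF2 (f2 x) &
  val al (jF3 x) = jF3 (f3 x)].
Proof. by have [h1 h2 h3] := diag0; split; rewrite /jF1 /jF2 /jF3 d ?h1 ?h2 ?h3. Qed.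

Lemma half_inj (V : lmodType R) : injective (fun x : V => 2^-1 *: x).
Proof.
move=> x y /eqP; rewrite -subr_eq0 -scalerBr => /eqP/half_eq0/eqP.
by rewrite subr_eq0 => /eqP.
Qed.

Lemma diag_triality x y :
  [/\ f1 (cconj (cmul x y)) = cconj (cmul (f2 x) (f3 y)),
      f2 (cconj (cmul x y)) = cconj (cmul (f3 x) (f1 y)) &
      f3 (cconj (cmul x y)) = cconj (cmul (f1 x) (f2 y))].
Proof.
have [x1 x2 x3] := diag_F x; have [y1 y2 y3] := diag_F y.
have [w1 w2 w3] := diag_F (2^-1 *: cconj (cmul x y)).
have [k1 k2 k3] := diagZ 2^-1 (cconj (cmul x y)) (cconj (cmul x y)) (cconj (cmul x y)).
split; apply: half_inj => /=.
- have := F4_jmul al (jF2 x) (jF3 y).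
  by rewrite x2 y3 !jmul_F2F3 w1 => /mkjordan_inj [_ _ _ [+ _ _]]; rewrite k1.
- have := F4_jmul al (jF3 x) (jF1 y).
  by rewrite x3 y1 !jmul_F3F1 w2 => /mkjordan_inj [_ _ _ [_ + _]]; rewrite k2.
- have := F4_jmul al (jF1 x) (jF2 y).
  by rewrite x1 y2 !jmul_F1F2 w3 => /mkjordan_inj [_ _ _ [_ _ +]]; rewrite k3.
Qed.

Lemma diag_cdot x y : cdot (f1 x) (f1 y) = cdot x y /\ cdot (f2 x) (f2 y) = cdot x y.
Proof.
have [x1 x2 _] := diag_F x; have [y1 y2 _] := diag_F y; split.
  have := F4_jmul al (jF1 x) (jF1 y); rewrite x1 y1 !jmul_F1F1 d.
  by move=> /mkjordan_inj [].
have := F4_jmul al (jF2 x) (jF2 y); rewrite x2 y2 !jmul_F2F2 d.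
by move=> /mkjordan_inj [].
Qed.

Lemma diag_gamma x :
  [/\ f1 (gamma3_cayley (omega R) x) = gamma3_cayley (omega R) (f1 x),
      f2 (gamma3_cayley (omega R) x) = gamma3_cayley (omega R) (f2 x) &
      f3 (gamma3_cayley (omega R) x) = gamma3_cayley (omega R) (f3 x)].
Proof.
have := F4_gamma hal (mkjordan 0 0 0 x x x); rewrite d !gamma3_mk d.
by move=> /mkjordan_inj [_ _ _ []].
Qed.

Lemma diag_sigma x :
  [/\ f1 (sigma3_cayley1 (omega R) x) = sigma3_cayley1 (omega R) (f1 x),
      f2 (sigma3_cayley2 (omega R) x) = sigma3_cayley2 (omega R) (f2 x) &
      f3 (sigma3_cayley3 (omega R) x) = sigma3_cayley3 (omega R) (f3 x)].
Proof.
have := F4_sigma hal (mkjordan 0 0 0 x x x); rewrite d !sigma3_mk d.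
by move=> /mkjordan_inj [_ _ _ []].
Qed.

(** The maps commute with [gamma3], whose fixed vectors in the Cayley algebra are the
    quaternions. *)
Lemma diag_quat m : cay2 (f1 (Cay m 0)) = 0 /\ cay2 (f2 (Cay m 0)) = 0.
Proof.
have [g1 g2 _] := diag_gamma (Cay m 0).
have gm : gamma3_cayley (omega R) (Cay m 0) = Cay m 0 by rewrite /gamma3_cayley /= mulr0.
by rewrite gm in g1 g2; split; apply: gamma3_fix.
Qed.

End Diagonal.

End Triality.

(** * Normalising the triality triple and computing it on generators *)

Section Surjectivity.
Variable R : realType.
Local Notation H := (quat R).
Local Notation C := (cayley R).
Local Notation J := (jordan R).
Local Notation cone := (Cay 1 0 : C).
Local Notation ce1 := (Cay (Quat 0 1 0 0) 0 : C).
Local Notation ce2 := (Cay (Quat 0 0 1 0) 0 : C).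
Local Notation ce4 := (Cay 0 1 : C).

Lemma qnorm_sum (q : H) :
  q0 q ^+ 2 + q1 q ^+ 2 + q2 q ^+ 2 + q3 q ^+ 2 = 1 -> qnorm q = 1.
Proof. by rewrite /qnorm => ->; rewrite sqrtr1. Qed.

Lemma cdot_sum (x : C) : cdot x x =
  q0 (cay1 x) ^+ 2 + q1 (cay1 x) ^+ 2 + q2 (cay1 x) ^+ 2 + q3 (cay1 x) ^+ 2 +
  (q0 (cay2 x) ^+ 2 + q1 (cay2 x) ^+ 2 + q2 (cay2 x) ^+ 2 + q3 (cay2 x) ^+ 2).
Proof. by case: x => [[? ? ? ?] [? ? ? ?]]; rewrite /cdot /=; ring. Qed.

Lemma cmul1x (x : C) : cmul cone x = x.
Proof. by case: x => [[? ? ? ?] [? ? ? ?]]; congr Cay; congr Quat => /=; ring. Qed.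

Lemma cmulx1 (x : C) : cmul x cone = x.
Proof. by case: x => [[? ? ? ?] [? ? ? ?]]; congr Cay; congr Quat => /=; ring. Qed.

Lemma cconj1 : cconj cone = cone.
Proof. by rewrite /cconj /= qconj1 oppr0. Qed.

(* half-angle formulas *)
Lemma unit_sqrt (a b : R) : a ^+ 2 + b ^+ 2 = 1 ->
  exists s t, [/\ s ^+ 2 + t ^+ 2 = 1, s ^+ 2 - t ^+ 2 = a & s * t *+ 2 = b].
Proof.
move=> h; have [a1|a1] := eqVneq a (-1).
  exists 0, 1; rewrite a1 in h *; have b0 : b = 0.
    by apply/eqP; rewrite -sqrf_eq0; apply/eqP; lra.
  by rewrite b0; split; ring.
have pa : 0 < (1 + a) / 2.
  have : -1 <= a by have := sqr_ge0 b; nra.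
  by rewrite le_eqVlt eq_sym (negbTE a1) /= => ?; lra.
have [s s2 s0] : exists2 s, s ^+ 2 = (1 + a) / 2 & s != 0.
  by exists (Num.sqrt ((1 + a) / 2)); rewrite ?sqr_sqrtr ?ltW // sqrtr_eq0 -ltNge.
have t2 : (b / (s *+ 2)) ^+ 2 = (1 - a) / 2.
  rewrite expr_div_n exprMn_n s2.
  rewrite (_ : b ^+ 2 = (1 + a) * (1 - a)); last first.
    by rewrite -[LHS](addKr (a ^+ 2)) h; ring.
  by field; apply/eqP => ?; move: pa; lra.
exists s, (b / (s *+ 2)); by split; [rewrite s2 t2; lra|rewrite s2 t2; lra|field].
Qed.

Section Core.
Variables (al : F4 R) (f1 f2 f3 : C -> C).
Hypotheses (hal : subgroup_set (F4_fixed2 R) al) (d : diag_by al f1 f2 f3).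
Hypotheses (f11 : f1 cone = cone) (f21 : f2 cone = cone).

(** Putting 1 for one argument in the triality relations identifies the three maps with each other;
    the relation that remains says that the common map is multiplicative. *)
Lemma core_eq : [/\ f2 =1 f1, f3 =1 f1 & {morph f1 : x y / cmul x y}].
Proof.
have f31 : f3 cone = cone.
  by have [_ _] := diag_triality d cone cone; rewrite f11 f21 !cmul1x !cconj1.
have A y : f1 (cconj y) = cconj (f3 y).
  by have [+ _ _] := diag_triality d cone y; rewrite f21 !cmul1x.
have B y : f1 (cconj y) = cconj (f2 y).
  by have [+ _ _] := diag_triality d y cone; rewrite f31 !cmulx1.
have D y : f2 (cconj y) = cconj (f3 y).
  by have [_ + _] := diag_triality d y cone; rewrite f11 !cmulx1.
have e2 : f2 =1 f1 by move=> x; rewrite -(cconjK x) D A.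
have e3 : f3 =1 f1 by move=> x; rewrite -e2; apply: (can_inj (@cconjK R)); rewrite -A B.
split=> // x y; apply: (can_inj (@cconjK R)).
have [+ _ _] := diag_triality d x y; rewrite e2 e3 => <-.
by rewrite B e2.
Qed.

(** On [x3] the map [sigma3] is right multiplication by [w], so commuting with it and fixing 1 means
    fixing [w], hence [e1]. *)
Lemma core_e1 : f1 ce1 = ce1.
Proof.
have [_ e3 _] := core_eq.
have [_ _ +] := diag_sigma hal d cone; rewrite /sigma3_cayley3 !e3 f11 !cmul1x.
have -> : cayley_of_quat (omega R) = - 2^-1 *: cone + (Num.sqrt 3 / 2) *: ce1.
  by congr Cay; congr Quat; rewrite /=; ring.
rewrite (diagD d); have [-> _ _] := diagZ d (- 2^-1) cone 0 0.
have [-> _ _] := diagZ d (Num.sqrt 3 / 2) ce1 0 0; rewrite f11 => /addrI.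
move/eqP; rewrite -subr_eq0 -scalerBr scaler_eq0 mulf_eq0 invr_eq0 pnatr_eq0 orbF.
by rewrite sqrtr_eq0 lern0 /= subr_eq0 => /eqP.
Qed.

(** The image of [e2] is a quaternion of norm one, orthogonal to the fixed vectors 1 and [e1]. *)
Lemma core_e2 : exists c2 c3, c2 ^+ 2 + c3 ^+ 2 = 1 /\ f1 ce2 = Cay (Quat 0 0 c2 c3) 0.
Proof.
have [h _] := diag_quat hal d (Quat 0 0 1 0).
have [k0 _] := diag_cdot d ce2 cone; have [k1 _] := diag_cdot d ce2 ce1.
have [k2 _] := diag_cdot d ce2 ce2.
rewrite f11 in k0; rewrite core_e1 in k1.
case: (f1 ce2) h k0 k1 k2 => [[a b c2 c3] n] /= ->.
rewrite !cdot_sum /cdot /= => k0 k1 k2.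
have a0 : a = 0 by lra.
have b0 : b = 0 by lra.
by exists c2, c3; rewrite a0 b0; split=> //; rewrite a0 b0 in k2; lra.
Qed.

(** The orbit sum of [e4] under [gamma3] is zero, so its image has no quaternion part. The image of
    [w e4] is [(w r) e4] because [f1] commutes with [gamma3], and [(r w) e4] because [f1] is
    multiplicative and fixes [w]. Thus [r] commutes with [w] and is complex. *)
Lemma core_e4 : exists r, [/\ complexes r, qnorm r = 1 & f1 ce4 = Cay 0 r].
Proof.
have [_ _ M] := core_eq.
have h : cay1 (f1 ce4) = 0.
  have := gamma3_sum (f1 ce4); have [g1 _ _] := diag_gamma hal d ce4.
  have [g2 _ _] := diag_gamma hal d (gamma3_cayley (omega R) ce4).
  rewrite -g1 -g2 -!(diagD d) gamma3_sum /= mul0rn -(_ : 0 = Cay 0 0 :> C) //.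
  have [-> _ _] := diag0 d; case: (cay1 (f1 ce4)) => a b c e [] *.
  by congr Quat; lra.
have [n _] := diag_cdot d ce4 ce4; move: n; rewrite !cdot_sum h.
have [g _ _] := diag_gamma hal d ce4; move: g.
have -> : gamma3_cayley (omega R) ce4 = cmul (cayley_of_quat (omega R)) ce4.
  by congr Cay; congr Quat; rewrite /=; ring.
rewrite M; have -> : f1 (cayley_of_quat (omega R)) = cayley_of_quat (omega R).
  have [_ e3 _] := core_eq.
  by have [_ _] := diag_sigma hal d cone; rewrite /sigma3_cayley3 !e3 f11 !cmul1x.
case: (f1 ce4) h => [m r] /= -> /(congr1 (@cay2 R)) /= e n.
exists r; split; last by [].
- apply/complexesP; move: e; rewrite mul0r add0r.
  case: r {n} => a b c e [_ _]; rewrite /omega /=.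
  have s3 : 0 < Num.sqrt 3 :> R by rewrite sqrtr_gt0 ltr0n.
  move: (Num.sqrt 3) s3 => s s3 h1 h2.
  have sc : s * c = 0 by lra.
  have se : s * e = 0 by lra.
  move/eqP: sc; rewrite mulf_eq0 (gt_eqF s3) => /eqP ->.
  by move/eqP: se; rewrite mulf_eq0 (gt_eqF s3) => /eqP ->.
- by apply: qnorm_sum; move: n => /=; lra.
Qed.

Lemma core_in_phi : in_phi al.
Proof.
have [e2 e3 M] := core_eq; have [c2 [c3 [c1 fe2]]] := core_e2.
have [r [cr nr fe4]] := core_e4.
have [s [t [st1 st2 st3]]] := unit_sqrt c1.
(* [u] is a square root of [c2 + c3 e1]; then [u e2 u^bar = u^2 e2] is the image of [e2], so [f1] is
   conjugation by [u] on [H]. *)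
pose u : H := Quat s t 0 0.
have cu : complexes u by apply/complexesP.
have nu : qnorm u = 1 by apply: qnorm_sum; rewrite /= !expr0n /= !addr0.
have fm m : f1 (Cay m 0) = Cay (u * m * qconj u) 0.
  have -> : Cay m 0 = (q0 m *: cone + q1 m *: ce1) + cmul (q2 m *: cone + q3 m *: ce1) ce2.
    by case: m => ? ? ? ?; congr Cay; congr Quat; rewrite /=; ring.
  have Z k x : f1 (k *: x) = k *: f1 x by have [-> _ _] := diagZ d k x 0 0.
  rewrite (diagD d) M !(diagD d) !Z f11 core_e1 fe2 -st2 -st3.
  have {}st1 : t ^+ 2 = 1 - s ^+ 2 by lra.
  by case: m => ? ? ? ?; congr Cay; congr Quat; rewrite /=; ring: st1.
(* Since [m + n e4] is the sum of [m] and the product of [n] with [e4], the values on [H] and on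
   [e4] determine [f1]. *)
have fE x : f1 x = Cay (u * cay1 x * qconj u) (r * u * cay2 x * qconj u).
  case: x => m n; have e : Cay m n = Cay m 0 + cmul (Cay n 0) ce4.
    by case: m n => ? ? ? ? [? ? ? ?]; congr Cay; congr Quat; rewrite /=; ring.
  rewrite [in LHS]e (diagD d) M !fm fe4; congr Cay => /=.
    by rewrite !mulr0 subr0 addr0.
  by rewrite mul0r !add0r !mulrA.
have [x hx] := phi_diag (complexesM cr cu) cu cu (qnormM nr nu) nu nu nu.
exists x; apply: F4_ext => X; rewrite (mkjordanE X) d hx.
by rewrite e2 e3 !fE.
Qed.

End Core.

Lemma sigma3_cayley1_quat m :
  sigma3_cayley1 (omega R) (Cay m 0) = Cay (qconj (omega R) * m * qconj (omega R)) 0.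
Proof. by rewrite /sigma3_cayley1 /cmul /= !(qconj0, mul0r, subr0, addr0). Qed.

Lemma omega_conj_mul23 m :
  q2 (qconj (omega R) * m * qconj (omega R)) = q2 m /\
  q3 (qconj (omega R) * m * qconj (omega R)) = q3 m.
Proof.
move: (omega_norm R); rewrite /omega /=; move: (- 2^-1) (Num.sqrt 3 / 2) => a b h.
have {}h : b ^+ 2 = 1 - a ^+ 2 by rewrite -h; ring.
by case: m => ? ? ? ?; split; rewrite /=; ring: h.
Qed.

Lemma diag_in_phi (al : F4 R) f1 f2 f3 :
  subgroup_set (F4_fixed2 R) al -> diag_by al f1 f2 f3 -> in_phi al.
Proof.
move=> hal d; have [h1 h2] := diag_quat hal d 1.
have [a E1] : exists a, f1 cone = Cay a 0.
  by exists (cay1 (f1 cone)); case: (f1 cone) h1 => ? ? /= ->.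
have [u E2] : exists u, f2 cone = Cay u 0.
  by exists (cay1 (f2 cone)); case: (f2 cone) h2 => ? ? /= ->.
have [n1 n2] := diag_cdot d cone cone; move: n1 n2; rewrite !cdot_sum E1 E2 /= => n1 n2.
have na : qnorm a = 1 by apply: qnorm_sum; lra.
have nu : qnorm u = 1 by apply: qnorm_sum; lra.
(* The orbit sum of 1 under [S] is [w^bar + w + 1 = 0], hence that of [a] vanishes too. As [S] fixes
   the [e2] and [e3] coordinates, three times each of them is zero for [a]. *)
have ca : complexes a.
  set S := sigma3_cayley1 (omega R).
  have s0 : S (S cone) + S cone + cone = 0.
    rewrite /S !sigma3_cayley1_quat mulr1 omega_conj_sqr (qconj_mul1 (omega_qnorm R)).
    by rewrite mul1r; congr Cay; congr Quat; rewrite /=; lra.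
  have g x : f1 (S x) = S (f1 x) by have [-> _ _] := diag_sigma hal d x.
  have := congr1 f1 s0; have [-> _ _] := diag0 d; rewrite !(diagD d) !g E1 /S.
  rewrite !sigma3_cayley1_quat; set m := _ * a * _; set m' := _ * m * _.
  have [m12 m13] : q2 m = q2 a /\ q3 m = q3 a := omega_conj_mul23 a.
  have [m22 m23] : q2 m' = q2 m /\ q3 m' = q3 m := omega_conj_mul23 m.
  move=> e; apply/complexesP.
  have := congr1 (fun z => q2 (cay1 z)) e; have := congr1 (fun z => q3 (cay1 z)) e.
  move: m m' m12 m13 m22 m23 {e} => m m' h1' h2' h3' h4' /= h5' h6'.
  by rewrite h3' h1' in h6'; rewrite h4' h2' in h5'; split; lra.
(* This element sends the pair of values [(a, u)] at 1 to [(a^bar a, u u^bar) = (1, 1)]. The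
   quaternion [u] goes into the [Sp(1)] slot, whereas the slot for [a^bar] requires a complex
   number. *)
have [x hx] := phi_diag (complexes1 R) (complexesJ ca) (complexes1 R) (qnorm1 R) nu
  (etrans (qnormJ a) na) (qnorm1 R).
apply: (@in_phi_mull _ x); apply: (core_in_phi _ (diag_byM hx d)).
- by apply: subgroupM => //; exact: phi_fixed.
- rewrite /= E1 /= (qconj_mul1 na) qconj1; congr Cay; rewrite ?mulr1 //.
  by rewrite mulr0 mul0r.
- rewrite /= E2 /= mul1r; move/qnorm1P: nu => ->; congr Cay.
  by rewrite mulr0 mul0r.
Qed.

Lemma phi_surj (al : F4 R) : subgroup_set (F4_fixed2 R) al -> in_phi al.
Proof.
move=> hal; have [x hx] := F4_fix_E2 hal.
apply: (@in_phi_inv _ x); set be := (_ * al)%g.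
have hbe : subgroup_set (F4_fixed2 R) be.
  by apply: subgroupM => //; apply: subgroupV; exact: phi_fixed.
have be2 : val be (jE2 R) = jE2 R.
  by rewrite /be F4_mulE -hx -F4_mulE mulVg.
have [f1 [f2 [f3 d]]] := F4_diag (F4_E1 hbe) be2.
exact: (diag_in_phi hbe d).
Qed.

End Surjectivity.

(** * Topology *)

Section GeneralTopology.

(** Continuous maps carry inseparable points to inseparable points, and these coincide in each
    Hausdorff target. *)
Lemma hausdorff_separated (T : topologicalType) (I : Type) (V : I -> topologicalType)
    (f : forall i, T -> V i) :
  (forall i, hausdorff_space (V i)) -> (forall i, continuous (f i)) ->
  (forall x y, (forall i, f i x = f i y) -> x = y) -> hausdorff_space T.
Proof.
move=> hV cf sep p q pq; apply: sep => i; apply: hV => A B /cf nA /cf nB.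
by have [z [Az Bz]] := pq _ _ nA nB; exists (f i z).
Qed.

(** A filter on the subtype is pushed forward to [T], where it clusters at a point of [A];
    neighbourhoods in the subtype come from open sets of [T], so it clusters there already. *)
Lemma compact_set_type (T : topologicalType) (A : set T) :
  compact A -> compact [set: set_type A].
Proof.
move=> cA F FF _.
have FA : (set_val @ F) A.
  by apply: (@filterS _ F _ setT) => [x _|]; [exact: set_valP|exact: filterT].
have [p [Ap clp]] := cA (set_val @ F) _ FA.
exists (SigSub (mem_set Ap)); split=> // B D FB [W [[V oV <-] Vp VD]].
have [x [[y By <-] Vy]] : ([set set_val y | y in B] `&` V) !=set0.
  apply: clp; last exact: (open_nbhs_nbhs (conj oV Vp)).
  by apply: (@filterS _ F _ B) => [y By|//]; exists y.
by exists y; split=> //; exact: VD.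
Qed.

Lemma closed_fiber (T V : topologicalType) (f : T -> V) (c : V) :
  hausdorff_space V -> continuous f -> closed [set x | f x = c].
Proof.
move=> hV cf; apply: (closed_comp (f := f) (D := [set c])) => [x _|]; first exact: cf.
exact/accessible_closed_set1/hausdorff_accessible.
Qed.

Lemma entry_continuous (T : topologicalType) m n i j :
  continuous (fun M : 'M[T]_(m, n) => M i j).
Proof.
(* Matrix neighbourhoods are families of neighbourhoods of the entries; this family constrains the
   entry [(i, j)] alone. *)
move=> M A nA; exists (fun k l => if (k == i) && (l == j) then A else setT).
  by move=> k l; case: andP => [[/eqP -> /eqP ->]|_] //; exact: filterT.
by move=> N /(_ i j); rewrite !eqxx.
Qed.

Lemma continuous_mx (X T : topologicalType) m n (F : X -> 'M[T]_(m, n)) :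
  (forall i j, continuous (fun x => F x i j)) -> continuous F.
Proof.
move=> cF x A [P nP PA]; apply: (@filterS _ _ _ [set y | forall i j, P i j (F y i j)]).
  by move=> y; exact: PA.
by apply: filter_forall => i; apply: filter_forall => j; exact: cF.
Qed.

(** The map from [K] picks a preimage under [h] and takes its class. The choice [s] need not be
    continuous or multiplicative, but its class does not depend on it. *)
Lemma compact_quotient_isomorphic (G K : groupTopologyType)
    (N : normal_subgroup G) (h : G -> K) :
  compact [set: G] -> hausdorff_space K -> continuous h ->
  {morph h : x y / (x * y)%g} -> (forall x, h x = 1%g <-> subgroup_set N x) ->
  (forall y, exists x, h x = y) -> isomorphic K (quotient_group N).
Proof.
move=> cG hK ch hM kN sh.
pose pi : G -> quotient_group N := \pi_(quotient_group N)%qT.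
have [s hs] := choice sh.
have h1 : h 1%g = 1%g by apply: (mulgI (h 1%g)); rewrite -hM !mulg1.
have hV x : h (x^-1)%g = (h x)^-1%g.
  by apply: (mulgI (h x)); rewrite -hM !mulgV.
have hpi x y : pi x = pi y <-> h x = h y.
  rewrite /pi coset_piP -kN hM hV; split=> [e|->]; last by rewrite mulVg.
  by apply: (mulgI (h x)^-1%g); rewrite e mulVg.
pose g (c : quotient_group N) := h (repr c).
have gpi x : g (pi x) = h x by apply/hpi; rewrite /pi reprK.
have fg : cancel (pi \o s) g by move=> y /=; rewrite gpi hs.
have gf : cancel g (pi \o s).
  by move=> c; have [x ->] := quot_surj c; apply/hpi; rewrite hs [g _]gpi.
exists (pi \o s), g; split => //.
- move=> x y; apply: (can_inj gf); rewrite fg.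
  by rewrite /= -quotient_group_piM gpi hM !hs.
- apply/continuous_closedP => A cA.
  (* The preimage of a closed set is the [h]-image of a closed, hence compact, subset of [G]; it is
     compact, and so closed in the Hausdorff group [K]. *)
  have -> : (pi \o s) @^-1` A = h @` (pi @^-1` A).
    apply/seteqP; split=> [y Ay|_ [x Ax <-]]; first by exists (s y); rewrite ?hs.
    by rewrite /= (_ : pi _ = pi x) //; apply/hpi; rewrite hs.
  apply: compact_closed => //; apply: continuous_compact.
    by apply: continuous_subspaceT.
  apply: (@subclosed_compact _ _ [set: G]) => //.
  by apply: closed_comp cA => x _; exact: quotient_group_pi_continuous.
- apply: quotient_group_continuous; rewrite (_ : g \o _ = h) //.
  by apply/funext => x; exact: gpi.
Qed.

End GeneralTopology.

(** * Continuity of [phi], compactness of its domain, separation of its target *)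

Section Topology.
Variable R : realType.
Local Notation H := (quat R).
Local Notation C := (cayley R).
Local Notation J := (jordan R).

Lemma comp_continuous (X Y Z : topologicalType) (f : X -> Y) (g : Y -> Z) :
  continuous g -> continuous f -> continuous (fun x => g (f x)).
Proof. by move=> cg cf x; apply: continuous_comp; [exact: cf|exact: cg]. Qed.

Lemma eq_continuous (X Y : topologicalType) (f g : X -> Y) :
  (forall x, g x = f x) -> continuous f -> continuous g.
Proof. by move=> /funext ->. Qed.

Lemma pair_continuous (X Y Z : topologicalType) (f : X -> Y) (g : X -> Z) :
  continuous f -> continuous g -> continuous (fun x => (f x, g x)).
Proof. by move=> cf cg x; apply: cvg_pair; [exact: cf|exact: cg]. Qed.

Lemma fst_continuous (X Y : topologicalType) : continuous (@fst X Y).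
Proof. by move=> x; exact: cvg_fst. Qed.

Lemma snd_continuous (X Y : topologicalType) : continuous (@snd X Y).
Proof. by move=> x; exact: cvg_snd. Qed.

Lemma quat_coord_continuous :
  [/\ continuous (@q0 R), continuous (@q1 R), continuous (@q2 R) & continuous (@q3 R)].
Proof.
have c : continuous (@quat_coords R : H -> _) := @initial_continuous _ _ _.
have c1 := comp_continuous (@fst_continuous _ _) c.
have c2 := comp_continuous (@fst_continuous _ _) c1.
split.
- exact: comp_continuous (@fst_continuous _ _) c2.
- exact: comp_continuous (@snd_continuous _ _) c2.
- exact: comp_continuous (@snd_continuous _ _) c1.
- exact: comp_continuous (@snd_continuous _ _) c.
Qed.

Lemma continuous_quat (X : topologicalType) (F : X -> H) :
  continuous (fun x => q0 (F x)) -> continuous (fun x => q1 (F x)) ->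
  continuous (fun x => q2 (F x)) -> continuous (fun x => q3 (F x)) -> continuous F.
Proof.
move=> c0 c1 c2 c3; apply: continuous_comp_initial.
by do 3 (apply: pair_continuous => //).
Qed.

Lemma cayley_coord_continuous : continuous (@cay1 R) /\ continuous (@cay2 R).
Proof.
have c : continuous (@cayley_coords R : C -> _) := @initial_continuous _ _ _.
split; first exact: comp_continuous (@fst_continuous _ _) c.
exact: comp_continuous (@snd_continuous _ _) c.
Qed.

Lemma continuous_cayley (X : topologicalType) (F : X -> C) :
  continuous (fun x => cay1 (F x)) -> continuous (fun x => cay2 (F x)) -> continuous F.
Proof. by move=> c0 c1; apply: continuous_comp_initial; apply: pair_continuous. Qed.

Section QuatOperations.
Variables (X : topologicalType) (F G : X -> H).
Hypotheses (cF : continuous F) (cG : continuous G).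

Lemma qcoord_continuous : [/\ continuous (fun x => q0 (F x)), continuous (fun x => q1 (F x)),
  continuous (fun x => q2 (F x)) & continuous (fun x => q3 (F x))].
Proof.
have [c0 c1 c2 c3] := quat_coord_continuous; split;
  by [exact: comp_continuous c0 cF|exact: comp_continuous c1 cF
     |exact: comp_continuous c2 cF|exact: comp_continuous c3 cF].
Qed.
End QuatOperations.

Section RealOperations.
Variables (X : topologicalType) (f g : X -> R).
Hypotheses (cf : continuous f) (cg : continuous g).

Lemma addR_continuous : continuous (fun x => f x + g x).
Proof. by move=> x; apply: cvgD; [exact: cf|exact: cg]. Qed.
Lemma oppR_continuous : continuous (fun x => - f x).
Proof. by move=> x; apply: cvgN; exact: cf. Qed.
Lemma mulR_continuous : continuous (fun x => f x * g x).
Proof. by move=> x; apply: cvgM; [exact: cf|exact: cg]. Qed.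
End RealOperations.

Lemma qadd_continuous (X : topologicalType) (F G : X -> H) :
  continuous F -> continuous G -> continuous (fun x => F x + G x).
Proof.
move=> /qcoord_continuous [? ? ? ?] /qcoord_continuous [? ? ? ?].
by apply: continuous_quat; apply: addR_continuous.
Qed.

Lemma qopp_continuous (X : topologicalType) (F : X -> H) :
  continuous F -> continuous (fun x => - F x).
Proof.
move=> /qcoord_continuous [? ? ? ?].
by apply: continuous_quat; apply: oppR_continuous.
Qed.

Lemma qconj_continuous (X : topologicalType) (F : X -> H) :
  continuous F -> continuous (fun x => qconj (F x)).
Proof.
move=> /qcoord_continuous [? ? ? ?].
by apply: continuous_quat => //; apply: oppR_continuous.
Qed.

Lemma qmul_continuous (X : topologicalType) (F G : X -> H) :
  continuous F -> continuous G -> continuous (fun x => F x * G x).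
Proof.
move=> /qcoord_continuous [f0 f1 f2 f3] /qcoord_continuous [g0 g1 g2 g3].
by apply: continuous_quat; rewrite /=; do 2 (apply: addR_continuous;
  [|by do ?apply: oppR_continuous; apply: mulR_continuous]);
  apply: addR_continuous; by do ?apply: oppR_continuous; apply: mulR_continuous.
Qed.

Lemma qcst_continuous (X : topologicalType) (c : H) : continuous (fun _ : X => c).
Proof. by move=> x; exact: cvg_cst. Qed.

Lemma qsum_continuous (X : topologicalType) n (F : 'I_n -> X -> H) :
  (forall i, continuous (F i)) -> continuous (fun x => \sum_i F i x).
Proof.
move=> cF; have -> : (fun x => \sum_i F i x) = (\sum_i F i).
  by apply/funext => x; rewrite fct_sumE.
apply: (big_ind (fun f : X -> H => continuous f)) => //.
  exact: qcst_continuous.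
by move=> f g cf cg; exact: (qadd_continuous cf cg).
Qed.

Lemma mulmx_entry_continuous (X : topologicalType) m n p (A : X -> 'M[H]_(m, n))
    (B : X -> 'M[H]_(n, p)) :
  (forall i j, continuous (fun x => A x i j)) ->
  (forall i j, continuous (fun x => B x i j)) ->
  forall i j, continuous (fun x => (A x *m B x) i j).
Proof.
move=> cA cB i j; rewrite (_ : (fun x => _) = fun x => \sum_k A x i k * B x k j).
  by apply: qsum_continuous => k; apply: qmul_continuous.
by apply/funext => x; rewrite mxE.
Qed.

Lemma adjmx_entry_continuous (X : topologicalType) m n (A : X -> 'M[H]_(m, n)) :
  (forall i j, continuous (fun x => A x i j)) ->
  forall i j, continuous (fun x => adjmx (A x) i j).
Proof.
move=> cA i j; rewrite (_ : (fun x => _) = fun x => qconj (A x j i)).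
  exact: qconj_continuous.
by apply/funext => x; rewrite !mxE.
Qed.

Lemma quat_hausdorff : hausdorff_space H.
Proof.
have [c0 c1 c2 c3] := quat_coord_continuous.
apply: (@hausdorff_separated _ 'I_4 (fun=> R)
  (fun i q => match val i with 0%N => q0 q | 1%N => q1 q | 2%N => q2 q | _ => q3 q end)).
- by move=> _; exact: Rhausdorff.
- by move=> [[|[|[|]]]].
- move=> [a b c e] [a' b' c' e'] h.
  have /= -> := h (@Ordinal 4 0 isT); have /= -> := h (@Ordinal 4 1 isT).
  by have /= -> := h (@Ordinal 4 2 isT); have /= -> := h (@Ordinal 4 3 isT).
Qed.

Lemma cayley_hausdorff : hausdorff_space C.
Proof.
have [c1 c2] := cayley_coord_continuous.
apply: (@hausdorff_separated _ bool (fun=> H) (fun b x => if b then cay1 x else cay2 x)).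
- by move=> _; exact: quat_hausdorff.
- by case.
- by move=> [m n] [m' n'] h; have /= -> := h true; have /= -> := h false.
Qed.

Lemma jordan_entry_continuous i j : continuous (fun X : J => jordan_mx X i j).
Proof.
by apply: (comp_continuous (@entry_continuous _ _ _ i j)); exact: initial_continuous.
Qed.

Lemma jordan_hausdorff : hausdorff_space J.
Proof.
apply: (@hausdorff_separated _ ('I_3 * 'I_3) (fun=> C) (fun ij X => jordan_mx X ij.1 ij.2)).
- by move=> _; exact: cayley_hausdorff.
- by move=> ij; exact: jordan_entry_continuous.
- by move=> X Y h; apply: jordan_inj => i j; exact: (h (i, j)).
Qed.

Lemma F4_eval_continuous (X : J) : continuous (fun al : F4 R => val al X).
Proof.
apply: (@comp_continuous (F4 R) {ptws J -> J} J (fun al => val al) (fun f => f X)).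
  exact: (@proj_continuous _ (fun=> J)).
exact: initial_continuous.
Qed.

(** [{ptws J -> J}] carries the supremum of the topologies pulled back along evaluations, so
    convergence is tested one evaluation at a time. *)
Lemma continuous_F4 (T : topologicalType) (F : T -> F4 R) :
  (forall X, continuous (fun t => val (F t) X)) -> continuous F.
Proof.
move=> cF; apply: continuous_comp_initial => t; apply/cvg_sup => X.
exact: (@continuous_comp_initial _ _ _ (fun f : J -> J => f X) _ (cF X) t).
Qed.

Lemma cconj_continuous (X : topologicalType) (F : X -> C) :
  continuous F -> continuous (fun x => cconj (F x)).
Proof.
have [c1 c2] := cayley_coord_continuous; move=> cF; apply: continuous_cayley.
  by apply: qconj_continuous; exact: comp_continuous c1 cF.
by apply: qopp_continuous; exact: comp_continuous c2 cF.
Qed.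

Lemma cayley_of_real_continuous (X : topologicalType) (F : X -> R) :
  continuous F -> continuous (fun x => cayley_of_real (F x)).
Proof.
move=> cF; apply: continuous_cayley; last exact: qcst_continuous.
by apply: continuous_quat => //= x; exact: cvg_cst.
Qed.

Lemma mkjordan_continuous (X : topologicalType) (a b c : X -> R) (x y z : X -> C) :
  continuous a -> continuous b -> continuous c ->
  continuous x -> continuous y -> continuous z ->
  continuous (fun t => mkjordan (a t) (b t) (c t) (x t) (y t) (z t)).
Proof.
move=> ca cb cc cx cy cz; apply: continuous_comp_initial; apply: continuous_mx.
apply: ord3P; apply: ord3P;
  (eapply eq_continuous; first by move=> t; rewrite /= mxE /=; reflexivity);
  by do ?[exact: cayley_of_real_continuous|exact: cconj_continuous].
Qed.

Lemma embed_continuous (X : topologicalType) (q : X -> H) (B : X -> 'M[H]_2) :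
  continuous q -> (forall i j, continuous (fun x => B x i j)) ->
  forall i j, continuous (fun x => embed (q x) (B x) i j).
Proof.
move=> cq cB; apply: ord3P; apply: ord3P;
  (eapply eq_continuous; first by move=> t; rewrite mxE /=; reflexivity);
  by do ?[exact: qcst_continuous|apply: qopp_continuous|apply: qmul_continuous
    |exact: cq|exact: cB].
Qed.

Lemma act_continuous (X : topologicalType) (p : X -> H) (A : X -> 'M[H]_3) (Z : J) :
  continuous p -> (forall i j, continuous (fun x => A x i j)) ->
  continuous (fun x => act (p x) (A x) Z).
Proof.
move=> cp cA.
have cM := mulmx_entry_continuous
  (mulmx_entry_continuous cA (fun i j => @qcst_continuous X (jH Z i j)))
  (adjmx_entry_continuous cA).
have cn : forall i j, continuous (fun x => (p x *: (jN Z *m adjmx (A x))) i j).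
  have cn' := mulmx_entry_continuous (fun i j => @qcst_continuous X (jN Z i j))
    (adjmx_entry_continuous cA).
  move=> i j; eapply eq_continuous; first by move=> t; rewrite mxE; reflexivity.
  exact: qmul_continuous.
have cc i j := qcoord_continuous (cM i j).
apply: mkjordan_continuous; rewrite /=;
  [by have [] := cc i0 i0
  |by have [] := cc i1 i1
  |by have [] := cc i2 i2
  |apply: continuous_cayley|apply: continuous_cayley|apply: continuous_cayley];
  rewrite /=; try exact: cn; exact: cM.
Qed.

Lemma set_val_continuous (T : topologicalType) (A : set T) :
  continuous (set_val : set_type A -> T).
Proof. exact: initial_continuous. Qed.

Lemma fixed2_hausdorff : hausdorff_space (subgroup_type (F4_fixed2 R)).
Proof.
apply: (@hausdorff_separated (subgroup_type (F4_fixed2 R)) J (fun=> jordan R)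
  (fun X al => val (val al) X)).
- by move=> _; exact: jordan_hausdorff.
- move=> X; apply: (comp_continuous (@F4_eval_continuous X)).
  exact: (@set_val_continuous (F4 R) (subgroup_set (F4_fixed2 R))).
- by move=> al be h; exact: fixed2_ext.
Qed.

Lemma phi_continuous : continuous (@phi R).
Proof.
apply: continuous_comp_initial; apply: continuous_F4 => X.
have c1 := @fst_continuous (U1 R * Sp1 R)%type (U R 2).
have c2 := @snd_continuous (U1 R * Sp1 R)%type (U R 2).
apply: act_continuous.
  apply: (comp_continuous (@set_val_continuous H _)).
  exact: comp_continuous (@fst_continuous (U1 R) (Sp1 R)) c1.
apply: embed_continuous.
  apply: (comp_continuous (@set_val_continuous H _)).
  exact: comp_continuous (@snd_continuous (U1 R) (Sp1 R)) c1.
move=> i j; apply: (comp_continuous (@entry_continuous _ _ _ i j)).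
by apply: (comp_continuous (@set_val_continuous 'M[H]_2 _)).
Qed.

(** A compact cube that contains all unit quaternions and all entries of unitary matrices. *)
Definition qbox : set H := [set q | [/\ `[-1, 1]%classic (q0 q), `[-1, 1]%classic (q1 q),
  `[-1, 1]%classic (q2 q) & `[-1, 1]%classic (q3 q)]].

Lemma qbox_compact : compact qbox.
Proof.
pose I := `[-1 : R, 1]%classic.
have cI : compact (I `*` I `*` I `*` I).
  by do 3 (apply: compact_setX; last exact: segment_compact); exact: segment_compact.
pose F (t : R * R * R * R) := Quat t.1.1.1 t.1.1.2 t.1.2 t.2.
have -> : qbox = F @` (I `*` I `*` I `*` I).
  apply/seteqP; split=> [[a b c e] [/= ? ? ? ?]|_ [[[[a b] c] e] [[[? ?] ?] ?] <-] //].
  by exists (a, b, c, e).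
apply: continuous_compact => //; apply: continuous_subspaceT.
have d1 := @fst_continuous (R * R * R)%type R.
have d2 := comp_continuous (@fst_continuous (R * R)%type R) d1.
apply: continuous_quat => /=.
- exact: comp_continuous (@fst_continuous R R) d2.
- exact: comp_continuous (@snd_continuous R R) d2.
- exact: comp_continuous (@snd_continuous (R * R)%type R) d1.
- exact: snd_continuous.
Qed.

Lemma qbox_sum (q : H) : q0 q ^+ 2 + q1 q ^+ 2 + q2 q ^+ 2 + q3 q ^+ 2 <= 1 -> qbox q.
Proof.
move=> h; have := sqr_ge0 (q0 q); have := sqr_ge0 (q1 q).
have := sqr_ge0 (q2 q); have := sqr_ge0 (q3 q) => *.
have b (t : R) : t ^+ 2 <= 1 -> `[-1, 1]%classic t.
  by move=> ht; rewrite /= in_itv /=; apply/andP; split; nra.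
by split; apply: b; lra.
Qed.

Lemma qconj_mulE (q : H) : q0 (qconj q * q) = q0 q ^+ 2 + q1 q ^+ 2 + q2 q ^+ 2 + q3 q ^+ 2.
Proof. by case: q => ? ? ? ?; rewrite /=; ring. Qed.

Lemma qnorm1_closed : closed [set q : H | qnorm q = 1].
Proof.
(* The equivalent polynomial equation replaces the square root in [qnorm], so that continuity of
   multiplication and conjugation suffices. *)
rewrite (_ : mkset _ = [set q | q * qconj q = 1]).
  apply: closed_fiber; first exact: quat_hausdorff.
  by apply: qmul_continuous; [|apply: qconj_continuous]; move=> x; exact: cvg_id.
by apply/seteqP; split=> q /qnorm1P.
Qed.

Lemma qnorm1_compact : compact [set q : H | qnorm q = 1].
Proof.
apply: (subclosed_compact qnorm1_closed qbox_compact) => q /qconj_mul1 h.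
by apply: qbox_sum; rewrite -qconj_mulE h.
Qed.

Lemma complexes_closed : closed (@complexes R).
Proof.
have [_ _ c2 c3] := quat_coord_continuous.
rewrite (_ : @complexes R = [set q | q2 q = 0] `&` [set q | q3 q = 0]).
  by apply: closedI; apply: closed_fiber => //; exact: Rhausdorff.
by apply/seteqP; split=> q /complexesP.
Qed.

Lemma U1_set_compact : compact [set q : H | complexes q /\ qnorm q = 1].
Proof.
apply: (subclosed_compact _ qnorm1_compact); last by move=> q [].
exact: closedI complexes_closed qnorm1_closed.
Qed.

Lemma unitary_closed n : closed [set A : 'M[H]_n | unitary A].
Proof.
have -> : [set A : 'M[H]_n | unitary A] =
    (\bigcap_i \bigcap_j [set A : 'M[H]_n | complexes (A i j)]) `&`
    (\bigcap_i \bigcap_j [set A : 'M[H]_n | (adjmx A *m A) i j = 1%:M i j]).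
  apply/seteqP; split=> A.
    by move=> [cA uA]; split=> i _ j _ //=; rewrite uA.
  move=> [cA uA]; split=> [i j|]; first exact: (cA i _ j).
  by apply/matrixP => i j; exact: (uA i _ j).
apply: closedI; apply: closed_bigI => i _; apply: closed_bigI => j _.
  apply: closed_comp complexes_closed => x _; exact: entry_continuous.
apply: closed_fiber; first exact: quat_hausdorff.
apply: mulmx_entry_continuous; last by move=> k l; exact: entry_continuous.
by apply: adjmx_entry_continuous => k l; exact: entry_continuous.
Qed.

Lemma unitary2_compact : compact [set A : 'M[H]_2 | unitary A].
Proof.
pose F (t : H * H * H * H) := mx2 t.1.1.1 t.1.1.2 t.1.2 t.2.
have cK : compact (F @` (qbox `*` qbox `*` qbox `*` qbox)).
  apply: continuous_compact.
    apply: continuous_subspaceT; apply: continuous_mx.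
    have d1 := @fst_continuous (H * H * H)%type H.
    have d2 := comp_continuous (@fst_continuous (H * H)%type H) d1.
    apply: ord2P; apply: ord2P;
      (eapply eq_continuous; first by move=> t; rewrite mxE /=; reflexivity).
    - exact: comp_continuous (@fst_continuous H H) d2.
    - exact: comp_continuous (@snd_continuous H H) d2.
    - exact: comp_continuous (@snd_continuous (H * H)%type H) d1.
    - exact: snd_continuous.
  by do 3 (apply: compact_setX; last exact: qbox_compact); exact: qbox_compact.
apply: (subclosed_compact (@unitary_closed 2) cK) => A [_ uA].
(* The diagonal entry [(j, j)] of [adjmx A *m A] is the sum of the squared norms in column [j]; it
   equals 1, which bounds each entry. *)
have h (i j : 'I_2) : qbox (A i j).
  apply: qbox_sum; have := congr1 (fun M : 'M[H]_2 => q0 (M j j)) uA.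
  rewrite !mxE eqxx /= q0_sum (bigD1 i) // !mxE qconj_mulE => <-.
  rewrite lerDl; apply: sumr_ge0 => k _; rewrite !mxE qconj_mulE.
  by rewrite !addr_ge0 // sqr_ge0.
exists (A j0 j0, A j0 j1, A j1 j0, A j1 j1); first by split; [split; [split|]|]; exact: h.
by apply/matrixP; apply: ord2P; apply: ord2P; rewrite !mxE.
Qed.

Lemma U1_Sp1_U2_compact : compact [set: U1_Sp1_U2 R].
Proof.
rewrite -!setXTT; apply: compact_setX; first apply: compact_setX.
- exact: compact_set_type U1_set_compact.
- exact: compact_set_type qnorm1_compact.
- exact: compact_set_type unitary2_compact.
Qed.

End Topology.

Theorem theorem4p2p2 (R : realType) :
  isomorphic
    (subgroup_type (subgroupI (F4_fixed (gamma3 R)) (F4_fixed (sigma3 R))))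
    (quotient_group (Z2 R)).
Proof.
apply: (compact_quotient_isomorphic (h := @phi R)).
- exact: U1_Sp1_U2_compact.
- exact: fixed2_hausdorff.
- exact: phi_continuous.
- exact: phiM.
- by move=> x; split; [exact: phi_eq1|exact: phi_Z2].
- move=> al; have [x hx] := phi_surj (subgroup_typeP al).
  by exists x; apply: val_inj.
Qed.
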